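(* Let $d\geq 2$, let $A$ be a (nonempty) convex compact set in $\mathbb{R}^d$, and let $(U_k)_{k\geq 1}$ be independent random variables with values in $\mathbb{S}^{d-1}$. Assume that there is $\alpha>0$ such that, for every $k\geq 1$, the distribution $\nu_k$ of $U_k$ is absolutely continuous with respect to $\sigma$ and its density satisfies $$\frac{d\nu_k}{d\sigma}(u)\leq\alpha<\frac{d}{d-1}\quad\text{for }\sigma\text{-a.e. }u\in\mathbb{S}^{d-1}.$$ Then there exists a constant $c>0$ such that, with probability $1$, $$\exists\, n_0=n_0(\omega),\ \forall n\geq n_0,\quad d_H\left(B_nA,\,L(A)D\right)\leq e^{-cn}.$$ Furthermore, the first random integer $n_0$ from which the inequality $d_H\left(B_nA,\,L(A)D\right)\leq e^{-cn}$ holds admits exponential moments.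
   Context: $\mathbb{S}^{d-1}$ is the Euclidean unit sphere of $\mathbb{R}^d$, $D$ the closed unit ball centered at the origin, $\sigma$ the rotation-invariant (Haar) probability measure on $\mathbb{S}^{d-1}$, and $d_H$ the Hausdorff distance. For $u\in\mathbb{S}^{d-1}$, the Minkowski symmetral of $A$ is $B_uA=\frac12(A\oplus\pi_u(A))$, where $\pi_u$ is the orthogonal reflection with respect to the hyperplane $u^\perp$ and $\oplus$ is the Minkowski sum. The set $B_nA$ is the random set $B_nA=B_{U_n}(\ldots B_{U_2}(B_{U_1}A)\ldots)$. The support function of $A$ is $f_A(\theta)=\sup_{x\in A}\langle x,\theta\rangle$, $\theta\in\mathbb{S}^{d-1}$, and the mean radius is $L(A)=\int_{\mathbb{S}^{d-1}}f_A\,d\sigma$. ''The first random integer $n_0$ from which the inequality holds'' is the smallest integer $N$ such that the inequality holds for all $n\geq N$; ''admits exponential moments'' means $\mathbb{E}[e^{\lambda n_0}]<\infty$ for some $\lambda>0$. *)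

(* Defs.v *)
From HB Require Import structures.
From mathcomp Require Import all_boot all_order all_algebra.
From mathcomp Require Import all_classical all_reals all_analysis.

Set Implicit Arguments.
Unset Strict Implicit.
Unset Printing Implicit Defensive.

Import Order.TTheory GRing.Theory Num.Theory.
Import numFieldNormedType.Exports.

Local Open Scope classical_set_scope.
Local Open Scope ring_scope.

(** The library norm on ['rV[R]_d] is the sup norm; it induces the usual
    topology (used for [compact] and for Borel sets), but every metric notion
    below uses the Euclidean norm [enorm]. *)

Section Euclidean.
Context {R : realType} {d : nat}.
Implicit Types (x y u : 'rV[R]_d) (A B : set 'rV[R]_d).

Definition dot x y : R := \sum_(i < d) x ord0 i * y ord0 i.

Definition enorm x : R := Num.sqrt (dot x x).

Definition sphere : set 'rV[R]_d := [set x | enorm x = 1].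

Definition unit_ball : set 'rV[R]_d := [set x | enorm x <= 1].

Definition dilate (r : R) A : set 'rV[R]_d := [set r *: x | x in A].

Definition minkowski_sum A B : set 'rV[R]_d :=
  [set a + b | a in A & b in B].

(** This is the reflection with respect to the hyperplane orthogonal to [u]
    only when [u] is a unit vector. *)
Definition reflection u x : 'rV[R]_d := x - (2 * dot x u) *: u.

Definition minkowski_symmetral u A : set 'rV[R]_d :=
  dilate 2^-1 (minkowski_sum A (reflection u @` A)).

(** The directions are indexed from 0: [u k] stands for the direction
    u_(k+1), so that the n-th set is B_{u_n} (... (B_{u_1} A)). *)
Fixpoint iter_symmetral (u : nat -> 'rV[R]_d) (n : nat) A : set 'rV[R]_d :=
  if n is m.+1 then minkowski_symmetral (u m) (iter_symmetral u m A) else A.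

Definition support_fun A (theta : 'rV[R]_d) : R := sup [set dot x theta | x in A].

(** Extended-real valued, so that no boundedness side condition is needed. *)
Definition hausdorff_dist A B : \bar R :=
  let excess X Y :=
    ereal_sup [set ereal_inf [set (enorm (x - y))%:E | y in Y] | x in X] in
  maxe (excess A B) (excess B A).

End Euclidean.

(** R^d with its Borel sigma-algebra.  Measures on the sphere are represented
    by Borel measures on R^d carried by [sphere]. *)
Definition borel_space (R : realType) (d : nat) :=
  g_sigma_algebraType (@open 'rV[R]_d).

(** [sigma] is the rotation-invariant probability measure on the sphere: it
    is carried by the sphere and invariant under the orthogonal group, which
    characterizes it when d >= 1. *)
Definition haar_sphere (R : realType) (d : nat)
    (sigma : probability (borel_space R d) R) : Prop :=
  sigma (@sphere R d : set (borel_space R d)) = 1%E /\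
  forall Q : 'M[R]_d, Q *m Q^T = 1%:M ->
  forall E : set (borel_space R d), measurable E ->
    sigma ((fun x : 'rV[R]_d => x *m Q) @^-1` E) = sigma E.

Definition mean_radius (R : realType) (d : nat)
    (sigma : probability (borel_space R d) R) (A : set 'rV[R]_d) : R :=
  \int[sigma]_(theta in (@sphere R d : set (borel_space R d)))
    support_fun A theta.

Definition mutually_independent (R : realType)
    (disp disp' : measure_display) (Omega : measurableType disp)
    (T : measurableType disp') (P : probability Omega R)
    (X : nat -> {RV P >-> T}) : Prop :=
  forall (J : seq nat) (E : nat -> set T),
    uniq J -> (forall k, measurable (E k)) ->
    P (\bigcap_(k in [set` J]) (X k @^-1` E k)) =
    (\big[*%E/1%E]_(k <- J) P (X k @^-1` E k)).

(** The smallest [N] such that [H n] holds for all [n >= N], and [+oo] if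
    there is no such [N]. *)
Definition first_index_from (R : realType) (H : nat -> Prop) : \bar R :=
  ereal_inf [set N%:R%:E | N in [set N : nat | forall n, (N <= n)%N -> H n]].

(* Main.v *)
Require Import Defs.
From HB Require Import structures.
From mathcomp Require Import all_boot all_order all_algebra.
From mathcomp Require Import all_classical all_reals all_analysis.
From mathcomp Require Import measurable_realfun ring lra.

Set Implicit Arguments.
Unset Strict Implicit.
Unset Printing Implicit Defensive.

Import Order.TTheory GRing.Theory Num.Theory.
Import numFieldNormedType.Exports.

Local Open Scope classical_set_scope.
Local Open Scope charge_scope.
Local Open Scope ring_scope.

(** Let f be the support function of A minus L(A). Symmetrizing along u replaces
    f by the average of f and its composition with the reflection pi_u, so that
    the expected square of the L2 norm of B_u f, for u uniform, is
    (|f|^2 + <Tf, f>) / 2, where Tf(x) is the average of f(pi_u x) over u.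
    The point is the sharp bound <Tf, f> <= (1 - 2/d) |f|^2 for f of mean 0:
    the density bound alpha < d / (d - 1) then makes the mean square decay
    geometrically along the independent directions.

    In the frame of the bisectors of x and y,
    <pi_u x, y> = <x, y> (1 - u_0^2 - u_1^2) - u_0^2 + u_1^2,
    so T maps the zonal convolution of f with <x, y>^K to a combination of those
    with <x, y>^j, j <= K, the diagonal coefficient being the mean of
    (1 - u_0^2 - u_1^2)^K, which is nonnegative and, for K >= 1, at most its value
    1 - 2/d at K = 1. Hence T^n decays at any rate above 1 - 2/d on zonal
    convolutions of f, which by log-convexity of <T^n g, g> bounds the Rayleigh
    quotient there; these functions approximate f uniformly.

    A Lipschitz function with small L2 norm is uniformly small, since a cap of
    radius r has mass at least of order r^d. Markov's inequality then makes the
    probability of d_H (B_n A, L(A) D) > e^(-cn) geometrically small. *)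

(** * Euclidean geometry *)

(** The threshold on alpha is the point where one step stops contracting. Averaging 1 and 1 - 2/d
    gives the factor 1 - 1/d under [sigma]; replacing the law of U_k by alpha times [sigma],
    legitimate for a nonnegative integrand, costs a factor alpha; and alpha (1 - 1/d) < 1 is exactly
    alpha < d / (d - 1). The obstacle is to reach 1 - 2/d without an eigenbasis of T. Rayleigh
    bounds for individual functions do not add up, whereas geometric decay rates do and survive a
    triangular recursion; so rates are propagated through the degrees K and only then converted into
    a Rayleigh bound. Decay rates in turn do not pass to uniform limits, but the Rayleigh inequality
    does, so the approximation by zonal convolutions comes after the conversion. Every reflection
    average preserves the mean and the Lipschitz bound of f, so the same constants serve at all
    steps. *)

Section Dot.
Context {R : realType} {d : nat}.
Implicit Types (x y z u v : 'rV[R]_d) (Q : 'M[R]_d).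

Lemma dotC x y : dot x y = dot y x.
Proof. by apply: eq_bigr => i _; rewrite mulrC. Qed.

Lemma dotDl x y z : dot (x + y) z = dot x z + dot y z.
Proof. by rewrite /dot -big_split; apply: eq_bigr => i _; rewrite mxE mulrDl. Qed.

Lemma dotZl (a : R) x y : dot (a *: x) y = a * dot x y.
Proof. by rewrite /dot mulr_sumr; apply: eq_bigr => i _; rewrite mxE mulrA. Qed.

Lemma dotNl x y : dot (- x) y = - dot x y.
Proof. by rewrite -scaleN1r dotZl mulN1r. Qed.

Lemma dotBl x y z : dot (x - y) z = dot x z - dot y z.
Proof. by rewrite dotDl dotNl. Qed.

Lemma dotDr x y z : dot x (y + z) = dot x y + dot x z.
Proof. by rewrite dotC dotDl !(dotC x). Qed.

Lemma dotZr (a : R) x y : dot x (a *: y) = a * dot x y.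
Proof. by rewrite dotC dotZl (dotC x). Qed.

Lemma dotNr x y : dot x (- y) = - dot x y.
Proof. by rewrite dotC dotNl (dotC x). Qed.

Lemma dotBr x y z : dot x (y - z) = dot x y - dot x z.
Proof. by rewrite dotDr dotNr. Qed.

Definition dotE := (dotDl, dotBl, dotNl, dotZl, dotDr, dotBr, dotNr, dotZr).

Lemma dot0l x : dot 0 x = 0.
Proof. by rewrite -(scale0r x) dotZl mul0r. Qed.

Lemma dot_ge0 x : 0 <= dot x x.
Proof. by apply: sumr_ge0 => i _; rewrite -expr2 sqr_ge0. Qed.

Lemma dot_eq0 x : (dot x x == 0) = (x == 0).
Proof.
rewrite psumr_eq0 => [|i _]; last by rewrite -expr2 sqr_ge0.
apply/allP/eqP => [h|-> i _]; last by rewrite mxE mul0r eqxx.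
apply/rowP => i; rewrite mxE; have := h i (mem_index_enum i).
by rewrite -expr2 sqrf_eq0 => /eqP.
Qed.

Lemma enorm_ge0 x : 0 <= enorm x. Proof. exact: sqrtr_ge0. Qed.

Lemma sqr_enorm x : enorm x ^+ 2 = dot x x.
Proof. by rewrite sqr_sqrtr// dot_ge0. Qed.

Lemma enorm_eq0 x : (enorm x == 0) = (x == 0).
Proof. by rewrite -sqrf_eq0 sqr_enorm dot_eq0. Qed.

Lemma enorm0 : enorm (0 : 'rV[R]_d) = 0.
Proof. by apply/eqP; rewrite enorm_eq0. Qed.

Lemma enormZ (a : R) x : enorm (a *: x) = `|a| * enorm x.
Proof. by rewrite /enorm dotZl dotZr mulrA -expr2 sqrtrM ?sqr_ge0// sqrtr_sqr. Qed.

Lemma enormN x : enorm (- x) = enorm x.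
Proof. by rewrite -scaleN1r enormZ normrN1 mul1r. Qed.

Lemma enormBC x y : enorm (x - y) = enorm (y - x).
Proof. by rewrite -enormN opprB. Qed.

Lemma sphereE x : sphere x <-> dot x x = 1.
Proof.
rewrite /sphere /= -sqr_enorm; split => [->|/eqP]; first by rewrite expr1n.
by rewrite sqrf_eq1 => /orP[/eqP//|/eqP h]; have := enorm_ge0 x; lra.
Qed.

Lemma cauchy_schwarz x y : dot x y ^+ 2 <= dot x x * dot y y.
Proof.
have [->|y0] := eqVneq y 0; first by rewrite dotC !dot0l mulr0 expr0n.
have yy : 0 < dot y y by rewrite lt_neqAle eq_sym dot_eq0 y0 dot_ge0.
have := dot_ge0 (dot y y *: x - dot x y *: y).
rewrite !dotE (dotC y x) => h.
have {}h : 0 <= dot y y * (dot x x * dot y y - dot x y ^+ 2) by lra.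
by move: h; rewrite pmulr_rge0// subr_ge0.
Qed.

Lemma dot_le x y : `|dot x y| <= enorm x * enorm y.
Proof.
rewrite -ler_sqr ?nnegrE ?mulr_ge0 ?enorm_ge0//.
by rewrite real_normK ?num_real// exprMn !sqr_enorm cauchy_schwarz.
Qed.

Lemma ler_enormD x y : enorm (x + y) <= enorm x + enorm y.
Proof.
rewrite -ler_sqr ?nnegrE ?addr_ge0 ?enorm_ge0//.
rewrite sqrrD !sqr_enorm !dotE (dotC y x).
have := le_trans (ler_norm _) (dot_le x y); rewrite -mulr_natl; lra.
Qed.

Lemma ler_coord_enorm x i : `|x ord0 i| <= enorm x.
Proof.
rewrite -ler_sqr ?nnegrE ?enorm_ge0// sqr_enorm real_normK ?num_real//.
rewrite /dot (bigD1 i)//= expr2 lerDl.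
by apply: sumr_ge0 => j _; rewrite -expr2 sqr_ge0.
Qed.

Lemma enorm_le_coord x (a : R) : 0 <= a -> (forall i, `|x ord0 i| <= a) ->
  enorm x <= d%:R * a.
Proof.
move=> a0 xa; rewrite -ler_sqr ?nnegrE ?enorm_ge0 ?mulr_ge0// sqr_enorm.
have h : dot x x <= \sum_(i < d) a ^+ 2.
  apply: ler_sum => i _; rewrite -expr2 -[leLHS]real_normK ?num_real//.
  by rewrite ler_sqr ?nnegrE.
apply: (le_trans h); rewrite sumr_const card_ord exprMn -[leLHS]mulr_natl.
by rewrite ler_wpM2r ?sqr_ge0// -natrX ler_nat; case: (d) => // n; rewrite expnS leq_pmulr.
Qed.

Lemma dot_reflectionl u x y : dot (reflection u x) y = dot x (reflection u y).
Proof. by rewrite /reflection !dotE (dotC u y) mulrAC. Qed.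

Lemma reflectionK u : sphere u -> involutive (reflection u).
Proof.
move=> /sphereE u1 x; rewrite /reflection !dotE u1 mulr1 -addrA -opprD -scalerDl.
have -> : 2 * dot x u + 2 * (dot x u - 2 * dot x u) = 0 by ring.
by rewrite scale0r subr0.
Qed.

Lemma reflectionB u x y : reflection u (x - y) = reflection u x - reflection u y.
Proof.
rewrite /reflection dotBl mulrBr scalerBl.
by apply/rowP => i; rewrite !mxE; ring.
Qed.

Lemma dot_reflection u x y : sphere u ->
  dot (reflection u x) (reflection u y) = dot x y.
Proof. by move=> su; rewrite dot_reflectionl reflectionK. Qed.

Lemma enorm_reflection u x : sphere u -> enorm (reflection u x) = enorm x.
Proof. by move=> su; rewrite /enorm dot_reflection. Qed.

Lemma reflection_sphere u x : sphere u -> sphere x -> sphere (reflection u x).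
Proof. by rewrite /sphere/= => su <-; rewrite enorm_reflection. Qed.

(** Haar invariance is stated for matrices acting on row vectors from the right; this is the
    reflection in that form. *)
Definition householder u : 'M[R]_d := 1%:M - 2 *: (u^T *m u).

Lemma mul_householder u x : x *m householder u = reflection u x.
Proof.
rewrite /householder /reflection mulmxBr mulmx1 -scalemxAr mulmxA.
congr (_ - _); rewrite -scalerA; congr (_ *: _).
have -> : x *m u^T = (dot x u)%:M.
  by apply/matrixP => i j; rewrite !mxE !ord1 eqxx mulr1n; apply: eq_bigr => k _; rewrite mxE.
by rewrite mul_scalar_mx.
Qed.

Lemma householder_orthogonal u : sphere u -> householder u *m (householder u)^T = 1%:M.
Proof.
move=> su.
have -> : (householder u)^T = householder u.
  by rewrite /householder linearB/= linearZ/= trmx_mul trmxK tr_scalar_mx.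
apply/row_matrixP => i; rewrite !rowE mulmxA !mul_householder reflectionK//.
by rewrite mulmx1.
Qed.

Lemma dot_orthogonal Q x y : Q *m Q^T = 1%:M -> dot (x *m Q) (y *m Q) = dot x y.
Proof.
have dotM z t : dot z t = (z *m t^T) ord0 ord0.
  by rewrite mxE; apply: eq_bigr => k _; rewrite mxE.
by move=> QQ; rewrite !dotM trmx_mul mulmxA -(mulmxA x) QQ mulmx1.
Qed.

(** For distinct vectors, take the reflection in the hyperplane bisecting [x] and [y]. That
    hyperplane consists of the [z] with [dot z x = dot z y], whence the last clause, which lets a
    second swap be composed with the first without undoing it. *)
Lemma exists_orthogonal_swap x y : dot x x = dot y y ->
  exists Q, [/\ Q *m Q^T = 1%:M, x *m Q = y &
    forall z, dot z x = dot z y -> z *m Q = z].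
Proof.
move=> xy; have [->|nxy] := eqVneq x y.
  by exists 1%:M; rewrite trmx1 !mulmx1; split => // z _; rewrite mulmx1.
have n0 : enorm (x - y) != 0 by rewrite enorm_eq0 subr_eq0.
pose u := (enorm (x - y))^-1 *: (x - y).
have su : sphere u.
  by rewrite /sphere/= enormZ ger0_norm ?invr_ge0 ?enorm_ge0// mulVf.
exists (householder u); split; first exact: householder_orthogonal.
- rewrite mul_householder /reflection /u dotZr scalerA.
  set c := (X in X *: _); have -> : c = 1; last by rewrite scale1r opprB addrC subrK.
  have e : dot x (x - y) = enorm (x - y) ^+ 2 / 2.
    by rewrite sqr_enorm !dotE -xy (dotC y x); lra.
  by rewrite /c e; field.
- move=> z zxy; rewrite mul_householder /reflection /u dotZr dotBr zxy subrr.
  by rewrite !mulr0 scale0r subr0.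
Qed.

Lemma exists_orthogonal2 x y x' y' : dot x x = dot x' x' -> dot y y = dot y' y' ->
  dot x y = dot x' y' ->
  exists Q, [/\ Q *m Q^T = 1%:M, x *m Q = x' & y *m Q = y'].
Proof.
move=> xx yy xy.
have [Q1 [oQ1 xQ _]] := exists_orthogonal_swap xx.
have y1 : dot (y *m Q1) (y *m Q1) = dot y' y' by rewrite dot_orthogonal.
have [Q2 [oQ2 yQ zQ]] := exists_orthogonal_swap y1.
exists (Q1 *m Q2); rewrite !mulmxA xQ; split => //.
- by rewrite trmx_mul mulmxA -(mulmxA Q1) oQ2 mulmx1.
- by apply: zQ; rewrite -xQ dot_orthogonal// xy -xQ.
Qed.

End Dot.

(** * Borel sets of the Euclidean space *)

Section Borel.
Context {R : realType} {d : nat}.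
Notation B := (borel_space R d).

Lemma open_measurable_borel (A : set B) : open (A : set 'rV[R]_d) -> measurable A.
Proof. by move=> oA; exact: sub_sigma_algebra. Qed.

Lemma continuous_measurable_borel (f : 'rV[R]_d -> R) :
  continuous f -> measurable_fun setT (f : B -> R).
Proof.
move=> /continuousP cf; apply: (measurability _ (RGenOpens.measurableE R)).
move=> _ [_ [a [b ->] <-]]; rewrite setTI; apply: open_measurable_borel.
exact/cf/interval_open.
Qed.

Lemma measurable_coord (i : 'I_d) :
  measurable_fun setT (fun x : B => (x : 'rV[R]_d) ord0 i).
Proof. by apply: continuous_measurable_borel; exact: coord_continuous. Qed.

(** Sup-norm balls with rational centers and radii 1/(n+1) form a countable base, and the preimage
    of such a ball is a finite intersection of conditions on coordinates. This reduces Borel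
    measurability of a vector-valued map to its coordinates. *)
Lemma open_bigcup_rat_ball (A : set 'rV[R]_d) : open A ->
  A = \bigcup_(p in [set p : 'rV[rat]_d * nat |
        ball (map_mx ratr p.1 : 'rV[R]_d) p.2.+1%:R^-1 `<=` A])
      ball (map_mx ratr p.1 : 'rV[R]_d) p.2.+1%:R^-1.
Proof.
move=> oA; apply/seteqP; split => [x Ax|x [p /= pA /pA//]].
have /nbhs_ballP[e /= e0 eA] : nbhs x A by exact: open_nbhs_nbhs.
(* The radius [n.+1%:R^-1] is below e / 2, so a ball of this radius that contains [x] lies in the
   ball of radius [e] around [x]. *)
pose n := Num.trunc (2 / e).
have ne : n.+1%:R^-1 < e / 2.
  rewrite -[ltRHS]invrK ltf_pV2 ?posrE ?invr_gt0 ?divr_gt0 ?ltr0n//.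
  rewrite invf_div; exact: truncnS_gt.
have n0 : 0 < n.+1%:R^-1 :> R by rewrite invr_gt0 ltr0n.
have /choice[q qP] (i : 'I_d) : exists q : rat, `|x ord0 i - ratr q| < n.+1%:R^-1.
  have /rat_in_itvoo[q] : x ord0 i - n.+1%:R^-1 < x ord0 i + n.+1%:R^-1.
    by rewrite ltrBlDr -addrA ltrDl addr_gt0.
  by rewrite in_itv/= => /andP[h1 h2]; exists q; rewrite ltr_distlC h1 h2.
exists (\row_i q i, n); last first.
  by split => // i j; rewrite !mxE (ord1 i) /ball/= distrC.
move=> y /= [_ yq]; apply: eA; split => // i j; have := yq i j.
rewrite !mxE (ord1 i) /ball/= => h2; have h1 := qP j.
rewrite -(subrK (ratr (q j)) (x ord0 j)) -addrA (le_lt_trans (ler_normD _ _))//.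
by rewrite [e]splitr ltrD// (lt_trans _ ne).
Qed.

Lemma measurable_borel_coordP disp (T : measurableType disp) (V : T -> B) :
  (forall i, measurable_fun setT (fun t => (V t : 'rV[R]_d) ord0 i)) ->
  measurable_fun setT V.
Proof.
move=> mV; apply: (@measurability _ _ _ B setT V (@open 'rV[R]_d)) => //.
move=> _ [A oA <-]; rewrite setTI (open_bigcup_rat_ball oA) preimage_bigcup.
rewrite bigcup_mkcond; apply: countable_bigcupT_measurable => [|p].
  exact: countableP.
case: ifPn => // _.
have -> : V @^-1` ball (map_mx ratr p.1 : 'rV[R]_d) p.2.+1%:R^-1 =
    \bigcap_(i : 'I_d) (fun t => (V t : 'rV[R]_d) ord0 i) @^-1`
       ball (ratr (p.1 ord0 i) : R) p.2.+1%:R^-1.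
  apply/seteqP; split => t /=.
    by move=> [_ h] i _ /=; have := h ord0 i; rewrite mxE.
  move=> h; split => [|i j]; first by rewrite invr_gt0 ltr0n.
  by rewrite ord1 mxE; exact: h.
apply: fin_bigcap_measurable => // i _.
rewrite -[X in measurable X]setTI; apply: mV => //.
exact: measurable_ball.
Qed.

Lemma measurable_dot disp (T : measurableType disp) (V W : T -> B) :
  measurable_fun setT V -> measurable_fun setT W ->
  measurable_fun setT (fun t => dot (V t) (W t)).
Proof.
move=> mV mW; apply: measurable_sum => i.
by apply: measurable_funM; apply: (measurableT_comp (measurable_coord i)).
Qed.

Lemma measurable_reflection disp (T : measurableType disp) (V W : T -> B) :
  measurable_fun setT V -> measurable_fun setT W ->
  measurable_fun setT (fun t => reflection (V t) (W t) : B).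
Proof.
move=> mV mW; apply: measurable_borel_coordP => i.
rewrite /reflection; under eq_fun do rewrite !mxE.
apply: measurable_funB; first exact: (measurableT_comp (measurable_coord i)).
apply: measurable_funM; last exact: (measurableT_comp (measurable_coord i)).
by apply: measurable_funM => //; exact: measurable_dot.
Qed.

Lemma measurable_mulmx (Q : 'M[R]_d) :
  measurable_fun setT (fun x : B => (x : 'rV[R]_d) *m Q : B).
Proof.
apply: measurable_borel_coordP => i; under eq_fun do rewrite mxE.
by apply: measurable_sum => k; apply: measurable_funM => //; exact: measurable_coord.
Qed.

Lemma measurable_enorm : measurable_fun setT (fun x : B => enorm (x : 'rV[R]_d)).
Proof.
apply: (@measurableT_comp _ _ _ _ _ _ (@Num.sqrt R) _ (fun x : B => dot x x)).
  by apply: continuous_measurable_fun; exact: sqrt_continuous.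
exact: (@measurable_dot _ B id id).
Qed.

Lemma measurable_sphere : measurable (@sphere R d : set B).
Proof.
have -> : @sphere R d = (fun x : B => enorm (x : 'rV[R]_d)) @^-1` [set 1].
  by apply/seteqP; split.
rewrite -[X in measurable X]setTI; exact: measurable_enorm.
Qed.

End Borel.

(** * Means over the sphere *)

Definition smean (R : realType) (d : nat) (sigma : probability (borel_space R d) R)
    (g : 'rV[R]_d -> R) : R :=
  \int[sigma]_(x in (@sphere R d : set (borel_space R d))) g x.

Section SphereMean.
Context {R : realType} {d : nat} {sigma : probability (borel_space R d) R}.
Notation B := (borel_space R d).
Notation S := (@sphere R d).
Implicit Types (g h : 'rV[R]_d -> R).

Notation smean := (smean sigma).

(** Boundedness is only required on the sphere: [smean] ignores the other values. *)
Definition sbounded g := measurable_fun setT (g : B -> R) /\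
  exists b, forall x, S x -> `|g x| <= b.

Lemma eq_smean g h : (forall x, S x -> g x = h x) -> smean g = smean h.
Proof. by move=> gh; apply: eq_Rintegral => x /set_mem; exact: gh. Qed.

Lemma smean_ge0 g : (forall x, S x -> 0 <= g x) -> 0 <= smean g.
Proof. by move=> g0; apply: Rintegral_ge0. Qed.

Lemma sbounded_cst c : sbounded (fun=> c).
Proof. by split => //; exists `|c|. Qed.

Lemma sboundedD g h : sbounded g -> sbounded h -> sbounded (fun x => g x + h x).
Proof.
move=> [mg [a ga]] [mh [b hb]]; split; first exact: measurable_funD.
by exists (a + b) => x Sx; rewrite (le_trans (ler_normD _ _))// lerD ?ga ?hb.
Qed.

Lemma sboundedM g h : sbounded g -> sbounded h -> sbounded (fun x => g x * h x).
Proof.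
move=> [mg [a ga]] [mh [b hb]]; split; first exact: measurable_funM.
by exists (a * b) => x Sx; rewrite normrM ler_pM ?ga ?hb.
Qed.

Lemma sboundedZ c g : sbounded g -> sbounded (fun x => c * g x).
Proof. by apply: sboundedM; exact: sbounded_cst. Qed.

Lemma sboundedN g : sbounded g -> sbounded (fun x => - g x).
Proof. by move=> /(sboundedZ (-1)); under eq_fun do rewrite mulN1r. Qed.

Lemma sboundedB g h : sbounded g -> sbounded h -> sbounded (fun x => g x - h x).
Proof. by move=> bg bh; apply: sboundedD => //; exact: sboundedN. Qed.

Lemma sboundedX g n : sbounded g -> sbounded (fun x => g x ^+ n).
Proof.
move=> bg; elim: n => [|n IH]; first exact: sbounded_cst.
by under eq_fun do rewrite exprS; exact: sboundedM.
Qed.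

Lemma sbounded_sum (I : Type) (s : seq I) (F : I -> 'rV[R]_d -> R) :
  (forall i, sbounded (F i)) -> sbounded (fun x => \sum_(i <- s) F i x).
Proof.
move=> bF; elim: s => [|i s IH].
  by under eq_fun do rewrite big_nil; exact: sbounded_cst.
by under eq_fun do rewrite big_cons; exact: sboundedD.
Qed.

Lemma sbounded_reflection u g : S u -> sbounded g -> sbounded (fun x => g (reflection u x)).
Proof.
move=> Su [mg [b gb]]; split.
  by apply: (measurableT_comp mg); exact: (@measurable_reflection _ _ _ B (cst u) id).
by exists b => x Sx; rewrite gb//; exact: reflection_sphere.
Qed.

Context (sigma_haar : haar_sphere sigma).

Lemma sphere_prob : sigma (S : set B) = 1%E.
Proof. by case: sigma_haar. Qed.

Lemma sbounded_integrable g : sbounded g ->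
  sigma.-integrable (S : set B) (EFin \o (g : B -> R)).
Proof.
move=> [mg [b gb]]; apply: measurable_bounded_integrable.
- exact: measurable_sphere.
- by rewrite (le_lt_trans (probability_le1 _ _)) ?ltry//; exact: measurable_sphere.
- exact: measurable_funTS.
- by exists b; split; [exact: num_real|move=> c bc x Sx; exact: le_trans (gb _ Sx) (ltW bc)].
Qed.

Let mS := @measurable_sphere R d.

Lemma smeanD g h : sbounded g -> sbounded h ->
  smean (fun x => g x + h x) = smean g + smean h.
Proof. by move=> bg bh; apply: RintegralD => //; exact: sbounded_integrable. Qed.

Lemma smeanB g h : sbounded g -> sbounded h ->
  smean (fun x => g x - h x) = smean g - smean h.
Proof. by move=> bg bh; apply: RintegralB => //; exact: sbounded_integrable. Qed.

Lemma smeanZ c g : sbounded g -> smean (fun x => c * g x) = c * smean g.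
Proof. by move=> bg; apply: RintegralZl => //; exact: sbounded_integrable. Qed.

Lemma smean_cst c : smean (fun=> c) = c.
Proof. by rewrite /smean Rintegral_cst//= sphere_prob mulr1. Qed.

Lemma smean_sum (I : Type) (s : seq I) (F : I -> 'rV[R]_d -> R) :
  (forall i, sbounded (F i)) ->
  smean (fun x => \sum_(i <- s) F i x) = \sum_(i <- s) smean (F i).
Proof.
move=> bF; elim: s => [|i s IH].
  by under eq_smean do rewrite big_nil; rewrite big_nil smean_cst.
under eq_smean do rewrite big_cons.
by rewrite smeanD ?IH ?big_cons//; exact: sbounded_sum.
Qed.

Lemma le_smean g h : sbounded g -> sbounded h -> (forall x, S x -> g x <= h x) ->
  smean g <= smean h.
Proof. by move=> bg bh gh; apply: le_Rintegral => //; exact: sbounded_integrable. Qed.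

Lemma le_smean_cst g c : sbounded g -> (forall x, S x -> g x <= c) -> smean g <= c.
Proof. by move=> bg gc; rewrite -[leRHS]smean_cst le_smean//; exact: sbounded_cst. Qed.

Lemma ler_norm_smean g b : sbounded g -> (forall x, S x -> `|g x| <= b) ->
  `|smean g| <= b.
Proof.
move=> bg gb; rewrite ler_norml; apply/andP; split.
  rewrite -[leLHS]smean_cst le_smean//; first exact: sbounded_cst.
  by move=> x /gb; rewrite ler_norml => /andP[].
by rewrite le_smean_cst// => x /gb; rewrite ler_norml => /andP[].
Qed.

Lemma EFin_smean g : sbounded g ->
  (smean g)%:E = (\int[sigma]_(x in (S : set B)) (g x)%:E)%E.
Proof.
move=> bg; rewrite fineK//.
by apply: integrable_fin_num => //; exact: sbounded_integrable.
Qed.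

(** Invariance is given for events; it extends to integrals through the pushforward measure, the
    sphere being its own preimage. *)
Lemma smean_orthogonal (Q : 'M[R]_d) g : Q *m Q^T = 1%:M -> sbounded g ->
  smean (fun x => g (x *m Q)) = smean g.
Proof.
move=> QQ bg; rewrite /smean /Rintegral; congr fine.
pose phi : B -> B := fun x : 'rV[R]_d => x *m Q.
have mphi : measurable_fun setT phi by exact: measurable_mulmx.
have phiS : phi @^-1` (S : set B) = S.
  by apply/seteqP; split => x; rewrite /phi /sphere/= /enorm dot_orthogonal.
have pushE (A : set B) : measurable A -> pushforward sigma phi A = sigma A.
  by move=> mA; rewrite /pushforward; case: sigma_haar => _ /(_ Q QQ A mA).
have mg : measurable_fun setT (EFin \o (g : B -> R)).
  by apply: measurableT_comp => //; case: bg.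
have ig : sigma.-integrable (phi @^-1` (S : set B)) ((EFin \o (g : B -> R)) \o phi).
  apply: measurable_bounded_integrable; rewrite ?phiS//.
  - by rewrite [X in (X < _)%E]sphere_prob ltry.
  - by apply: measurable_funTS; apply: measurableT_comp => //; case: bg.
  - case: bg => _ [b gb]; exists b; split; first exact: num_real.
    move=> c bc x Sx; apply: le_trans (ltW bc); apply: gb.
    by move: Sx; rewrite -{1}phiS.
rewrite -{1}phiS -(integral_pushforward mphi mg ig)//.
by apply: eq_measure_integral => A mA _; exact: pushE.
Qed.

Lemma measurable_smean disp (T : measurableType disp) (F : T -> 'rV[R]_d -> R) :
  measurable_fun setT (fun p : T * B => F p.1 p.2) ->
  measurable_fun setT (fun t => smean (F t)).
Proof.
move=> mF; apply: measurableT_comp; first exact: fine_measurable.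
pose f (p : T * B) : \bar R := ((fun p : T * B => F p.1 p.2) \_ (setT `*` (S : set B)) p)%:E.
have mf : measurable_fun setT f.
  apply: measurableT_comp => //; apply/(measurable_restrict _ _ _) => //.
    exact: measurableX.
  by apply: measurable_funTS.
have -> : (fun t => \int[sigma]_(x in (S : set B)) (F t x)%:E)%E =
  (fun t => \int[sigma]_x f^\+ (t, x) - \int[sigma]_x f^\- (t, x))%E.
  apply/funext => t; rewrite integral_mkcond.
  have -> : (fun x : B => (F t x)%:E) \_ (S : set B) = (fun x => f (t, x)).
    by apply/funext => x; rewrite /f !patchE in_setX/= in_setT/=; case: ifP.
  rewrite [LHS]integralE; under eq_integral do rewrite funepos_comp/=.
  by under [X in (_ - X)%E = _]eq_integral do rewrite funeneg_comp/=.
apply: emeasurable_funB; apply: measurable_fun_fubini_tonelli_F => //.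
  exact: measurable_funepos.
exact: measurable_funeneg.
Qed.

Lemma smean_exchange (F : 'rV[R]_d -> 'rV[R]_d -> R) b :
  measurable_fun setT (fun p : B * B => F p.1 p.2) ->
  (forall x y, S x -> S y -> `|F x y| <= b) ->
  smean (fun x => smean (F x)) = smean (fun y => smean (F ^~ y)).
Proof.
move=> mF bF.
(* The bound holds on the sphere only, so the kernel is extended by 0 before Fubini is applied on
   the whole space. *)
pose f (p : B * B) : R := ((fun p : B * B => F p.1 p.2) \_ ((S : set B) `*` (S : set B)) p).
have mf : measurable_fun setT f.
  apply/(measurable_restrict _ _ _) => //; first exact: measurableX.
  exact: measurable_funTS.
have fb p : `|f p| <= `|b|.
  rewrite /f /patch; case: ifPn => [|_]; last by rewrite normr0.
  by rewrite inE => -[? ?]; rewrite (le_trans (bF _ _ _ _))// ler_norm.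
have intf : (sigma \x sigma)%E.-integrable setT (EFin \o f).
  apply: measurable_bounded_integrable => //.
    have e : (sigma \x sigma)%E ([set: B] `*` [set: B]) = (1 * 1)%E.
      by rewrite product_measure1E//; congr (_ * _)%E; exact: probability_setT.
    by rewrite -setXTT [X in (X < _)%E]e mule1 ltry.
  by exists `|b|; split; [exact: num_real|move=> c bc x _; exact: le_trans (fb _) (ltW bc)].
rewrite /smean /Rintegral; congr fine.
transitivity (\int[sigma]_x \int[sigma]_y (f (x, y))%:E)%E.
  rewrite integral_mkcond; apply: eq_integral => x _; rewrite patchE.
  case: ifPn => xS; last first.
    by rewrite integral0_eq// => y _; rewrite /f /= patchE in_setX/= (negbTE xS).
  rewrite EFin_smean.
    rewrite integral_mkcond; apply: eq_integral => y _.
    by rewrite /f /= !patchE in_setX/= xS; case: ifP.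
  split; first exact: (measurableT_comp mF (pair1_measurable x)).
  by exists b => y; apply: bF; exact: set_mem.
rewrite (Fubini intf); apply/esym.
rewrite integral_mkcond; apply: eq_integral => y _; rewrite patchE.
case: ifPn => yS; last first.
  by rewrite integral0_eq// => x _; rewrite /f /= patchE in_setX/= (negbTE yS) andbF.
rewrite EFin_smean.
  rewrite integral_mkcond; apply: eq_integral => x _.
  by rewrite /f /= !patchE in_setX/= yS andbT; case: ifP.
split; first exact: (measurableT_comp mF (pair2_measurable y)).
by exists b => x Sx; apply: bF => //; exact: set_mem.
Qed.

Lemma smean_reflection u g : S u -> sbounded g ->
  smean (fun x => g (reflection u x)) = smean g.
Proof.
move=> Su bg; rewrite -(smean_orthogonal (householder_orthogonal Su) bg).
by apply: eq_smean => x _; rewrite mul_householder.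
Qed.

End SphereMean.

(** * Averages over random reflections *)

Definition savg (R : realType) (d : nat) (sigma : probability (borel_space R d) R)
    (g : 'rV[R]_d -> R) (x : 'rV[R]_d) : R :=
  smean sigma (fun u => g (reflection u x)).

Section Averaging.
Context {R : realType} {d : nat} {sigma : probability (borel_space R d) R}
  (sigma_haar : haar_sphere sigma).
Notation B := (borel_space R d).
Notation S := (@sphere R d).
Notation smean := (smean sigma).
Notation savg := (savg sigma).
Implicit Types (g h f : 'rV[R]_d -> R).

Lemma smean_cauchy_schwarz g h : sbounded g -> sbounded h ->
  smean (fun x => g x * h x) ^+ 2 <= smean (fun x => g x ^+ 2) * smean (fun x => h x ^+ 2).
Proof.
move=> bg bh; set p := smean (fun x => g x * h x).
set q := smean (fun x => g x ^+ 2); set r := smean (fun x => h x ^+ 2).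
have bg2 := sboundedX 2 bg; have bh2 := sboundedX 2 bh; have bgh := sboundedM bg bh.
have q0 : 0 <= q by apply: smean_ge0 => x _; exact: sqr_ge0.
have r0 : 0 <= r by apply: smean_ge0 => x _; exact: sqr_ge0.
(* The quadratic form in (s, t) is nonnegative. The choice (r, -p) gives r (q r - p^2) >= 0; when r
   = 0, the choice (p, -(q + 1)) gives -p^2 (q + 2) >= 0, so p = 0. *)
have key (s t : R) : 0 <= s ^+ 2 * q + 2 * s * t * p + t ^+ 2 * r.
  have -> : s ^+ 2 * q + 2 * s * t * p + t ^+ 2 * r =
      smean (fun x => (s * g x + t * h x) ^+ 2).
    rewrite -!smeanZ// -!smeanD;
      do ?[exact: sboundedD|exact: sboundedZ|apply: sboundedD|apply: sboundedZ] => //.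
    by apply: eq_smean => x _; ring.
  by apply: smean_ge0 => x _; exact: sqr_ge0.
have [r00|rn0] := eqVneq r 0.
  rewrite r00 mulr0 real_exprn_even_le0 ?num_real//=; apply/eqP.
  apply: contrapT => /eqP pn0.
  have := key p (- (q + 1)); rewrite r00.
  have : 0 < p ^+ 2 by rewrite exprn_even_gt0.
  by move: q0; clear; nra.
have rp : 0 < r by rewrite lt_neqAle eq_sym rn0.
have := key r (- p) => h1.
have {h1}: 0 <= r * (q * r - p ^+ 2) by lra.
by rewrite pmulr_rge0// subr_ge0.
Qed.

Lemma sbounded_orbit g x : S x -> sbounded g -> sbounded (fun u => g (reflection u x)).
Proof.
move=> Sx [mg [b gb]]; split; last by exists b => u Su; rewrite gb//; exact: reflection_sphere.
apply: (measurableT_comp mg); exact: (@measurable_reflection _ _ _ B id (cst x)).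
Qed.

Lemma measurable_orbit g : measurable_fun setT (g : B -> R) ->
  measurable_fun setT (fun p : B * B => g (reflection p.2 p.1)).
Proof.
by move=> mg; apply: (measurableT_comp mg); apply: measurable_reflection.
Qed.

Lemma sbounded_savg g : sbounded g -> sbounded (savg g).
Proof.
move=> bg; have [mg [b gb]] := bg; split.
  by apply: (@measurable_smean _ _ _ _ B (fun x u => g (reflection u x))); exact: measurable_orbit.
exists b => x Sx; apply: ler_norm_smean => //; first exact: sbounded_orbit.
by move=> u Su; rewrite gb//; exact: reflection_sphere.
Qed.

Lemma eq_savg g h x : (forall y, S y -> g y = h y) -> S x -> savg g x = savg h x.
Proof. by move=> gh Sx; apply: eq_smean => u Su; rewrite gh//; exact: reflection_sphere. Qed.

Lemma savgD g h x : sbounded g -> sbounded h -> S x ->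
  savg (fun y => g y + h y) x = savg g x + savg h x.
Proof. by move=> bg bh Sx; apply: smeanD => //; exact: sbounded_orbit. Qed.

Lemma savgZ c g x : sbounded g -> S x -> savg (fun y => c * g y) x = c * savg g x.
Proof. by move=> bg Sx; apply: smeanZ => //; exact: sbounded_orbit. Qed.

(** Each reflection is a measure-preserving involution, so for fixed [u] it can be moved from one
    factor to the other; exchanging the two means does the rest. *)
Lemma savg_sym g h : sbounded g -> sbounded h ->
  smean (fun x => savg g x * h x) = smean (fun x => g x * savg h x).
Proof.
move=> bg bh; have [mg [a ga]] := bg; have [mh [b hb]] := bh.
transitivity (smean (fun x => smean (fun u => g (reflection u x) * h x))).
  apply: eq_smean => x Sx; rewrite /savg mulrC -smeanZ; last exact: sbounded_orbit.
  by apply: eq_smean => u _; rewrite mulrC.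
rewrite (@smean_exchange _ _ _ _ (a * b)); first last.
- move=> x u Sx Su; rewrite normrM ler_pM ?ga ?hb//; exact: reflection_sphere.
- by apply: measurable_funM; [exact: measurable_orbit|exact: (measurableT_comp mh)].
transitivity (smean (fun u => smean (fun x => g x * h (reflection u x)))).
  apply: eq_smean => u Su; rewrite -[LHS](smean_reflection sigma_haar Su).
    by apply: eq_smean => x _; rewrite reflectionK.
  by apply: sboundedM => //; exact: sbounded_reflection.
rewrite (@smean_exchange _ _ _ _ (a * b)); first last.
- move=> u x Su Sx; rewrite normrM ler_pM ?ga ?hb//; exact: reflection_sphere.
- apply: measurable_funM; first exact: (measurableT_comp mg).
  by apply: (measurableT_comp mh); apply: measurable_reflection.
apply: eq_smean => x Sx; rewrite /savg -smeanZ//; exact: sbounded_orbit.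
Qed.

Lemma sbounded_iter_savg n g : sbounded g -> sbounded (iter n savg g).
Proof. by move=> bg; elim: n => //= n; exact: sbounded_savg. Qed.

Lemma eq_iter_savg n g h x : (forall y, S y -> g y = h y) -> S x ->
  iter n savg g x = iter n savg h x.
Proof. by move=> gh; elim: n x => [|n IH] x Sx /=; [exact: gh|exact: eq_savg]. Qed.

Lemma iter_savgD n g h x : sbounded g -> sbounded h -> S x ->
  iter n savg (fun y => g y + h y) x = iter n savg g x + iter n savg h x.
Proof.
move=> bg bh; elim: n x => //= n IH x Sx; rewrite (eq_savg IH)//.
by rewrite savgD//; exact: sbounded_iter_savg.
Qed.

Lemma iter_savgZ n c g x : sbounded g -> S x ->
  iter n savg (fun y => c * g y) x = c * iter n savg g x.
Proof.
move=> bg; elim: n x => //= n IH x Sx; rewrite (eq_savg IH)//.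
by rewrite savgZ//; exact: sbounded_iter_savg.
Qed.

Definition savg_decay (m : R) g := exists C, forall n x, S x -> `|iter n savg g x| <= C * m ^+ n.

Lemma savg_decay_eq m g h : (forall y, S y -> g y = h y) -> savg_decay m g -> savg_decay m h.
Proof.
by move=> gh [C gC]; exists C => n x Sx; rewrite -(eq_iter_savg _ gh)// gC.
Qed.

Lemma savg_decayD m g h : sbounded g -> sbounded h -> savg_decay m g ->
  savg_decay m h -> savg_decay m (fun y => g y + h y).
Proof.
move=> bg bh [C gC] [D hD]; exists (C + D) => n x Sx.
by rewrite iter_savgD// mulrDl (le_trans (ler_normD _ _))// lerD ?gC ?hD.
Qed.

Lemma savg_decayZ m c g : sbounded g -> savg_decay m g -> savg_decay m (fun y => c * g y).
Proof.
move=> bg [C gC]; exists (`|c| * C) => n x Sx.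
by rewrite iter_savgZ// normrM -mulrA ler_wpM2l// gC.
Qed.

Lemma savg_decay0 m : 0 <= m -> savg_decay m (fun=> 0).
Proof.
move=> m0; exists 0 => n x Sx; rewrite mul0r.
have -> : (fun=> 0 : R) = (fun y : 'rV[R]_d => 0 * (0 : R)) by apply/funext => y; rewrite mul0r.
by rewrite iter_savgZ// ?mul0r ?normr0//; exact: sbounded_cst.
Qed.

Lemma savg_decay_sum m (I : Type) (s : seq I) (F : I -> 'rV[R]_d -> R) : 0 <= m ->
  (forall i, sbounded (F i)) -> (forall i, savg_decay m (F i)) ->
  savg_decay m (fun x => \sum_(i <- s) F i x).
Proof.
move=> m0 bF dF; elim: s => [|i s IH].
  by under eq_fun do rewrite big_nil; exact: savg_decay0.
under eq_fun do rewrite big_cons.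
by apply: savg_decayD => //; exact: sbounded_sum.
Qed.

(** The iterates satisfy T^(n+1) g = l T^n g + T^n h, a recursion whose forcing is at most C m^n.
    The strict gap l < m absorbs the forcing into a larger constant. *)
Lemma savg_decay_triangular m l g h : 0 <= l < m -> sbounded g -> sbounded h ->
  (forall x, S x -> savg g x = l * g x + h x) -> savg_decay m h -> savg_decay m g.
Proof.
move=> /andP[l0 lm] bg bh gE [C hC]; have [_ [b gb]] := bg.
have m0 : 0 < m by exact: le_lt_trans lm.
(* The first entry handles n = 0; the second gives l D + C <= m D, which is the induction step. *)
exists (Num.max b (C / (m - l))); elim=> [|n IH] x Sx.
  by rewrite expr0 mulr1 le_max gb.
rewrite iterSr (eq_iter_savg _ gE)// iter_savgD//; last exact: sboundedZ.
rewrite iter_savgZ//; set D := Num.max _ _.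
have CD : C <= (m - l) * D.
  by rewrite mulrC -ler_pdivrMr ?subr_gt0// /D le_max lexx orbT.
rewrite (le_trans (ler_normD _ _))// normrM (ger0_norm l0) exprS.
apply: (@le_trans _ _ (l * (D * m ^+ n) + (m - l) * D * m ^+ n)).
  rewrite lerD//; first by rewrite ler_wpM2l// IH.
  by rewrite (le_trans (hC _ _ Sx))// ler_wpM2r// exprn_ge0// ltW.
by rewrite le_eqVlt; apply/orP; left; apply/eqP; ring.
Qed.

(* Log-convexity of [n |-> <savg^n g, g>] turns the decay rate of the iterates into a
   bound on the Rayleigh quotient. *)
Lemma savg_rayleigh l g : 0 <= l -> sbounded g ->
  (forall m, l < m -> savg_decay m g) ->
  smean (fun x => savg g x * g x) <= l * smean (fun x => g x ^+ 2).
Proof.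
move=> l0 bg dg; pose a n := smean (fun x => iter n savg g x * g x).
have bn n : sbounded (iter n savg g) by exact: sbounded_iter_savg.
have aD m n : a (m + n)%N = smean (fun x => iter m savg g x * iter n savg g x).
  rewrite /a; elim: n m => [|n IH] m; first by rewrite addn0.
  by rewrite -addSnnS IH /= savg_sym.
have a0 : a 0%N = smean (fun x => g x ^+ 2) by apply: eq_smean => x _; rewrite expr2.
have N0 : 0 <= a 0%N by rewrite a0 smean_ge0// => x _; exact: sqr_ge0.
have cs n : a n ^+ 2 <= a 0%N * a (n + n)%N.
  rewrite aD a0 mulrC /a (le_trans (smean_cauchy_schwarz (bn n) bg))//.
rewrite -a0 -/(a 1%N); have [a00|Nn0] := eqVneq (a 0%N) 0.
  have := cs 1%N; rewrite a00 mul0r mulr0 => h.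
  by have : a 1%N ^+ 2 == 0; [rewrite eq_le h sqr_ge0|rewrite sqrf_eq0 => /eqP ->].
have Np : 0 < a 0%N by rewrite lt_neqAle eq_sym Nn0.
rewrite leNgt; apply/negP => al.
(* Suppose the quotient r exceeds [l] and place [m] strictly between. Doubling the exponent with
   [cs] keeps a(2^j) above a(0) r^(2^j), while decay at rate [m] keeps it below a constant times
   m^(2^j); this is impossible for large j. *)
pose r := a 1%N / a 0%N; pose m := (l + r) / 2.
have lr : l < r by rewrite /r ltr_pdivlMr.
have lm : l < m by rewrite /m; lra.
have mr : m < r by rewrite /m; lra.
have m0 : 0 < m by exact: le_lt_trans lm.
have low j : a 0%N * r ^+ (2 ^ j) <= a (2 ^ j)%N.
  elim: j => [|j IH]; first by rewrite expn0 expr1 /r mulrC divfK.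
  have h1 : (a 0%N * r ^+ (2 ^ j)) ^+ 2 <= a (2 ^ j)%N ^+ 2.
    rewrite ler_sqr// nnegrE; last by apply: le_trans IH; rewrite mulr_ge0// exprn_ge0//; lra.
    by rewrite mulr_ge0// exprn_ge0//; lra.
  rewrite expnS mul2n -addnn -(ler_pM2l Np); apply: le_trans (cs _).
  by apply: le_trans h1; rewrite exprD expr2 mulrACA mulrA -expr2 expr2 !mulrA.
have [C gC] := dg m lm; have [_ [b gb]] := bg.
have up n : a n <= C * m ^+ n * b.
  apply: (le_smean_cst sigma_haar); first exact: sboundedM.
  move=> x Sx; apply: (le_trans (ler_norm _)); rewrite normrM.
  by rewrite ler_pM ?gC ?gb.
pose t := r / m - 1; have t0 : 0 < t by rewrite /t subr_gt0 ltr_pdivlMr// mul1r.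
(* Bernoulli's inequality bounds (r / m)^(2^j) below by 1 + j t, so that an explicit [j] gives the
   contradiction. *)
have bern n : 1 + n%:R * t <= (r / m) ^+ n.
  have -> : r / m = 1 + t by rewrite /t; ring.
  elim: n => [|n IH]; first by rewrite mul0r addr0 expr0.
  rewrite exprS; apply: le_trans (ler_wpM2l _ IH); last by lra.
  rewrite -natr1; have := ler0n R n; move: t0; clear; nra.
have bnd j : a 0%N * (1 + j%:R * t) <= C * b.
  apply: (@le_trans _ _ (a 0%N * (r / m) ^+ (2 ^ j))).
    rewrite ler_pM2l// (le_trans _ (bern _))// lerD2l ler_pM2r// ler_nat.
    exact/ltnW/ltn_expl.
  rewrite expr_div_n mulrA ler_pdivrMr ?exprn_gt0//.
  by rewrite (le_trans (low j))// (le_trans (up _))// mulrAC.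
pose j := Num.trunc (C * b / (a 0%N * t)).
have := bnd j.+1; apply/negP; rewrite -ltNge.
have : C * b / (a 0%N * t) < j.+1%:R by exact: truncnS_gt.
rewrite ltr_pdivrMr ?mulr_gt0// => h; rewrite mulrDr mulr1 (lt_le_trans h)//.
by rewrite mulrCA lerDr ltW.
Qed.

End Averaging.

(** * Zonal kernels *)

Section Zonal.
Context {R : realType} {d : nat} {sigma : probability (borel_space R d) R}
  (sigma_haar : haar_sphere sigma).
Notation B := (borel_space R d).
Notation S := (@sphere R d).
Notation smean := (smean sigma).
Notation savg := (savg sigma).
Implicit Types (g h f : 'rV[R]_d -> R) (x y u : 'rV[R]_d).

Lemma dot_sphere_le1 x y : S x -> S y -> `|dot x y| <= 1.
Proof. by move=> Sx Sy; rewrite (le_trans (dot_le _ _))// Sx Sy mulr1. Qed.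

Lemma sbounded_dot x : sbounded (dot x).
Proof.
split; first exact: (@measurable_dot _ _ _ B (cst x) id).
by exists (enorm x) => y Sy; rewrite (le_trans (dot_le _ _))// Sy mulr1.
Qed.

Lemma sbounded_coord (i : 'I_d) : sbounded (fun u => u ord0 i).
Proof.
split; first exact: measurable_coord.
by exists 1 => u Su; rewrite -Su; exact: ler_coord_enorm.
Qed.

(** The mean depends only on the Gram matrix of the pair, since an orthogonal map carries one pair
    to the other. *)
Lemma smean_gram2 x y x' y' (F : R -> R -> R) :
  dot x x = dot x' x' -> dot y y = dot y' y' -> dot x y = dot x' y' ->
  sbounded (fun u => F (dot x' u) (dot y' u)) ->
  smean (fun u => F (dot x u) (dot y u)) = smean (fun u => F (dot x' u) (dot y' u)).
Proof.
move=> xx yy xy bF; have [Q [QQ xQ yQ]] := exists_orthogonal2 xx yy xy.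
rewrite -[RHS](smean_orthogonal sigma_haar QQ bF).
by apply: eq_smean => u _; rewrite -xQ -yQ !dot_orthogonal.
Qed.

Lemma dot_delta (i : 'I_d) u : dot (delta_mx ord0 i) u = u ord0 i.
Proof.
rewrite /dot (bigD1 i)//= mxE !eqxx mul1r big1 ?addr0// => j ji.
by rewrite mxE (negbTE ji) andbF mul0r.
Qed.

(** By invariance all coordinates have the same mean square, and their squares sum to 1 on the
    sphere. *)
Lemma smean_sqr_coord (i : 'I_d) : smean (fun u => u ord0 i ^+ 2) = d%:R^-1.
Proof.
have d0 : d%:R != 0 :> R by rewrite pnatr_eq0; case: (d) i => [[]|].
have e (j : 'I_d) : smean (fun u => u ord0 j ^+ 2) = smean (fun u => u ord0 i ^+ 2).
  under eq_smean do rewrite -dot_delta.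
  under [RHS]eq_smean do rewrite -dot_delta.
  (* Only one inner product occurs here, so the second vector is 0 on both sides. *)
  apply: (smean_gram2 (y := 0) (y' := 0) (F := fun a _ => a ^+ 2)) => //;
    rewrite ?dot_delta ?(dotC _ 0) ?dot0l ?mxE ?eqxx//.
  exact/sboundedX/sbounded_dot.
apply: (mulfI d0); rewrite mulfV//.
transitivity (\sum_(j < d) smean (fun u => u ord0 j ^+ 2)).
  by under eq_bigr do rewrite e; rewrite sumr_const card_ord -[RHS]mulr_natl.
rewrite -(smean_sum sigma_haar); last by move=> j; exact/sboundedX/sbounded_coord.
rewrite -[RHS](smean_cst sigma_haar); apply: eq_smean => u /sphereE <-.
by apply: eq_bigr => j _; rewrite expr2.
Qed.

Context (i0 i1 : 'I_d) (i01 : i0 != i1).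

(** With s = <x, y>, the inner product <pi_u x, y> becomes s A + V in the frame of the bisectors. *)
Let A u : R := 1 - u ord0 i0 ^+ 2 - u ord0 i1 ^+ 2.
Let V u : R := u ord0 i1 ^+ 2 - u ord0 i0 ^+ 2.

Let bA : sbounded A.
Proof.
apply: sboundedB; last exact/sboundedX/sbounded_coord.
apply: sboundedB; [exact: sbounded_cst|exact/sboundedX/sbounded_coord].
Qed.

Let bV : sbounded V.
Proof. by apply: sboundedB; exact/sboundedX/sbounded_coord. Qed.

Let A01 u : S u -> 0 <= A u <= 1.
Proof.
move=> /sphereE; rewrite /dot (bigD1 i0)//= (bigD1 i1)//=; last by rewrite eq_sym.
have : 0 <= \sum_(i < d | (i != i0) && (i != i1)) u ord0 i * u ord0 i.
  by apply: sumr_ge0 => j _; rewrite -expr2 sqr_ge0.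
rewrite -!expr2 /A => h e.
have := sqr_ge0 (u ord0 i0); have := sqr_ge0 (u ord0 i1) => h0 h1.
by apply/andP; split; lra.
Qed.

(* The frame of the two bisectors of [x] and [y] makes the product of the two
   inner products a difference of squares. *)
Lemma smean_dot_reflection x y (K : nat) : S x -> S y ->
  smean (fun u => dot (reflection u x) y ^+ K) =
  smean (fun u => (dot x y * A u + V u) ^+ K).
Proof.
move=> Sx Sy; set s := dot x y.
have s1 := dot_sphere_le1 Sx Sy; rewrite -/s ler_norml in s1.
have /andP[s1l s1r] := s1.
(* These are the cosine and sine of half the angle between [x] and [y]: the vectors x' and y' have
   the Gram matrix of [x] and [y], and the product of their inner products with [u] is a^2 u_0^2 -
   b^2 u_1^2. *)
pose a := Num.sqrt ((1 + s) / 2); pose b := Num.sqrt ((1 - s) / 2).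
have a2 : a * a = (1 + s) / 2 by rewrite -expr2 sqr_sqrtr//; lra.
have b2 : b * b = (1 - s) / 2 by rewrite -expr2 sqr_sqrtr//; lra.
pose x' : 'rV[R]_d := a *: delta_mx ord0 i0 + b *: delta_mx ord0 i1.
pose y' : 'rV[R]_d := a *: delta_mx ord0 i0 - b *: delta_mx ord0 i1.
have x'E u : dot x' u = a * u ord0 i0 + b * u ord0 i1 by rewrite !dotE !dot_delta.
have y'E u : dot y' u = a * u ord0 i0 - b * u ord0 i1 by rewrite !dotE !dot_delta.
have dd : (i1 == i0) = false by rewrite eq_sym (negbTE i01).
transitivity (smean (fun u => (s - 2 * (dot x u * dot y u)) ^+ K)).
  by apply: eq_smean => u _; rewrite /reflection !dotE (dotC u y) mulrA.
rewrite (smean_gram2 (x' := x') (y' := y') (F := fun p q => (s - 2 * (p * q)) ^+ K)).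
- apply: eq_smean => u _; rewrite x'E y'E; congr (_ ^+ _).
  transitivity (s - 2 * (a * a) * u ord0 i0 ^+ 2 + 2 * (b * b) * u ord0 i1 ^+ 2); first by ring.
  by rewrite a2 b2 /A /V; field.
- rewrite (sphereE x).1// x'E !mxE !eqxx/= dd (negbTE i01)/=.
  by rewrite !(mulr0, mulr1, addr0, add0r) a2 b2; field.
- rewrite (sphereE y).1// y'E !mxE !eqxx/= dd (negbTE i01)/=.
  by rewrite !(mulr0, mulr1, addr0, add0r, subr0, sub0r) mulrN opprK a2 b2; field.
- rewrite x'E !mxE !eqxx/= dd (negbTE i01)/= -/s.
  by rewrite !(mulr0, mulr1, addr0, add0r, subr0, sub0r) mulrN a2 b2; field.
- apply: sboundedX; apply: sboundedB; first exact: sbounded_cst.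
  by apply: sboundedZ; apply: sboundedM; exact: sbounded_dot.
Qed.

(** The coefficient of s^j in the mean of (s A + V)^K. These numbers form the lower triangular
    matrix of [savg] on the functions [zonal f K], with the means of A^K on its diagonal. *)
Let c (K j : nat) : R := 'C(K, j)%:R * smean (fun u => V u ^+ (K - j) * A u ^+ j).

Lemma smean_dot_reflectionE x y (K : nat) : S x -> S y ->
  smean (fun u => dot (reflection u x) y ^+ K) = \sum_(j < K.+1) c K j * dot x y ^+ j.
Proof.
move=> Sx Sy; rewrite smean_dot_reflection//.
under eq_smean => u _ do rewrite addrC exprDn.
have bVA j : sbounded (fun u => V u ^+ (K - j) * A u ^+ j).
  by apply: sboundedM; exact: sboundedX.
transitivity (smean (fun u => \sum_(j < K.+1)
    'C(K, j)%:R * dot x y ^+ j * (V u ^+ (K - j) * A u ^+ j))).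
  apply: eq_smean => u _; apply: eq_bigr => j _.
  by rewrite -mulr_natl exprMn; ring.
rewrite (smean_sum sigma_haar) => [|j]; last exact: sboundedZ.
by apply: eq_bigr => j _; rewrite smeanZ// /c mulrAC.
Qed.

Definition zonal f (K : nat) x := smean (fun y => dot x y ^+ K * f y).

Lemma sbounded_zonal f K : sbounded f -> sbounded (zonal f K).
Proof.
move=> [mf [b fb]]; split.
  apply: (@measurable_smean _ _ _ _ B (fun x y => dot x y ^+ K * f y)).
  apply: measurable_funM; last exact: (measurableT_comp mf).
  by apply: measurable_funX; exact: measurable_dot.
exists b => x Sx; apply: (ler_norm_smean sigma_haar).
  by apply: sboundedM => //; [exact/sboundedX/sbounded_dot|split => //; exists b].
move=> y Sy; rewrite normrM normrX -[leRHS]mul1r ler_pM// ?fb// ?exprn_ge0//.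
by rewrite exprn_ile1// dot_sphere_le1.
Qed.

(** Exchanging the means over [u] and [y] leaves, for each [y], the mean over [u] of
    [dot (reflection u x) y ^+ K], a polynomial of degree at most [K] in [dot x y]. *)
Lemma savg_zonal f K x : sbounded f -> S x ->
  savg (zonal f K) x = \sum_(j < K.+1) c K j * zonal f j x.
Proof.
move=> bf Sx; have [mf [b fb]] := bf.
rewrite /savg /zonal (@smean_exchange _ _ _ _ b); first last.
- move=> u y Su Sy; rewrite normrM normrX -[leRHS]mul1r ler_pM// ?fb// ?exprn_ge0//.
  by rewrite exprn_ile1// dot_sphere_le1//; exact: reflection_sphere.
- apply: measurable_funM; last exact: (measurableT_comp mf).
  apply: measurable_funX; apply: measurable_dot => //.
  exact: (@measurable_reflection _ _ _ _ fst (cst x)).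
have bd y n : sbounded (fun u => dot (reflection u x) y ^+ n).
  apply: sboundedX; split; first by apply: (@measurable_dot _ _ _ B _ (cst y)) => //;
    exact: (@measurable_reflection _ _ _ B id (cst x)).
  exists (enorm x * enorm y) => u Su.
  by rewrite (le_trans (dot_le _ _))// enorm_reflection.
transitivity (smean (fun y => \sum_(j < K.+1) c K j * (dot x y ^+ j * f y))).
  apply: eq_smean => y Sy.
  under eq_smean do rewrite mulrC.
  rewrite smeanZ// smean_dot_reflectionE// mulr_sumr.
  by apply: eq_bigr => j _; ring.
have bdf j : sbounded (fun y => dot x y ^+ j * f y).
  by apply: sboundedM => //; exact/sboundedX/sbounded_dot.
rewrite (smean_sum sigma_haar) => [|j]; last exact: sboundedZ.
by apply: eq_bigr => j _; rewrite smeanZ.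
Qed.

Let lam1 : c 1 1 = 1 - 2 / d%:R.
Proof.
rewrite /c binn mul1r subnn; under eq_smean do rewrite expr0 mul1r expr1.
rewrite smeanB ?smeanB ?(smean_cst sigma_haar) ?smean_sqr_coord;
  do ?[exact: sbounded_cst|exact/sboundedX/sbounded_coord|apply: sboundedB]; lra.
Qed.

Let lamE K : c K K = smean (fun u => A u ^+ K).
Proof. by rewrite /c binn mul1r subnn; under eq_smean do rewrite expr0 mul1r. Qed.

Let lam_ge0 K : 0 <= c K K.
Proof. by rewrite lamE; apply: smean_ge0 => u /A01/andP[A0 _]; exact: exprn_ge0. Qed.

(** [A] takes values in [0, 1], so the mean of A^K is nonincreasing in K. *)
Let lam_le K : (0 < K)%N -> c K K <= 1 - 2 / d%:R.
Proof.
move=> K0; rewrite -lam1 !lamE; apply: le_smean => [| |u /A01/andP[A0 A1]]; try exact: sboundedX.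
by rewrite expr1 -[leRHS]expr1 ler_wiXn2l.
Qed.

Lemma lam1_ge0 : 0 <= 1 - 2 / d%:R :> R.
Proof. by rewrite -lam1. Qed.

(** In degree 0 the diagonal entry is 1, but there the zonal function is the mean of [f], which
    vanishes. In higher degrees the triangular recursion applies by strong induction. *)
Lemma zonal_decay f (m : R) (K : nat) : sbounded f -> smean f = 0 -> 1 - 2 / d%:R < m ->
  savg_decay (sigma := sigma) m (zonal f K).
Proof.
move=> bf f0 lm; have m0 : 0 <= m by exact/ltW/(le_lt_trans lam1_ge0).
elim/ltn_ind: K => -[_|K IH].
  apply: savg_decay_eq (savg_decay0 sigma_haar m0) => y Sy.
  by rewrite /zonal; under eq_smean do rewrite expr0 mul1r.
have bz j : sbounded (zonal f j) by exact: sbounded_zonal.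
apply: (@savg_decay_triangular _ _ _ _ _ (c K.+1 K.+1) _
  (fun x => \sum_(j < K.+1) c K.+1 j * zonal f j x)) => //.
- by rewrite lam_ge0 (le_lt_trans (lam_le _)).
- by apply: sbounded_sum => j; exact: sboundedZ.
- by move=> x Sx; rewrite savg_zonal// big_ord_recr/= addrC.
- have dz (j : 'I_K.+1) : savg_decay (sigma := sigma) m (fun x => c K.+1 j * zonal f j x).
    by apply: savg_decayZ => //; exact: IH.
  by apply: savg_decay_sum => // j; exact: sboundedZ.
Qed.

End Zonal.

(** * Spherical caps *)

Section Caps.
Context {R : realType} {d : nat} {sigma : probability (borel_space R d) R}
  (sigma_haar : haar_sphere sigma).
Notation B := (borel_space R d).
Notation S := (@sphere R d).
Notation smean := (smean sigma).
Notation savg := (savg sigma).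
Implicit Types (g h f : 'rV[R]_d -> R) (x y u z : 'rV[R]_d).

(** A ball of the ambient space; [smean] sees only its trace on the sphere. *)
Definition cap z (r : R) : set 'rV[R]_d := [set x | enorm (x - z) <= r].

Lemma sbounded_indic (A : set 'rV[R]_d) : measurable (A : set B) -> sbounded (\1_A).
Proof.
move=> mA; split; first exact: measurable_indic.
by exists 1 => x _; rewrite indicE; case: (_ \in _); rewrite ?normr1 ?normr0.
Qed.

Lemma measurable_cap z r : measurable (cap z r : set B).
Proof.
have m : measurable_fun setT (fun x : B => enorm ((x : 'rV[R]_d) - z)).
  apply: (measurableT_comp measurable_enorm).
  apply: measurable_borel_coordP => i; under eq_fun do rewrite !mxE.
  by apply: measurable_funB => //; exact: measurable_coord.
rewrite -[X in measurable X]setTI.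
by have := m measurableT _ (measurable_itv `]-oo, r]); congr measurable;
  apply/seteqP; split => x /=; rewrite in_itv.
Qed.

Lemma sbounded_cap z r : sbounded (\1_(cap z r)).
Proof. by apply: sbounded_indic; exact: measurable_cap. Qed.

Lemma smean_cap_eq x y r : S x -> S y -> smean (\1_(cap x r)) = smean (\1_(cap y r)).
Proof.
move=> /sphereE xx /sphereE yy.
have [Q [QQ xQ _]] := @exists_orthogonal_swap _ _ x y (etrans xx (esym yy)).
rewrite -(smean_orthogonal sigma_haar QQ (sbounded_cap y r)).
apply: eq_smean => z _; rewrite !indicE; congr (nat_of_bool _)%:R.
by apply/idP/idP; rewrite !inE /cap/= -xQ -mulmxBl /enorm dot_orthogonal.
Qed.

(** The cube [-1, 1]^d is covered by k^d overlapping cells, and a point of the sphere is chosen in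
    each cell that meets it, with [z] as default in the others. Points of a common cell differ by at
    most 4 / k in each coordinate. *)
Lemma sphere_net z k : (0 < k)%N -> S z ->
  exists pt : {ffun 'I_d -> 'I_k} -> 'rV[R]_d, (forall c, S (pt c)) /\
    forall x, S x -> exists c, enorm (x - pt c) <= d%:R * (4 / k%:R).
Proof.
move=> k0 Sz; have k0' : 0 < k%:R :> R by rewrite ltr0n.
pose cell (c : {ffun 'I_d -> 'I_k}) : set 'rV[R]_d :=
  [set x | S x /\ forall i, `|(x ord0 i + 1) * (k%:R / 2) - (c i)%:R| <= 1].
have ptS (c : {ffun 'I_d -> 'I_k}) : S (xget z (cell c)) by case: xgetP => // x _ [].
exists (fun c => xget z (cell c)); split => // x Sx.
have pk : (k.-1 < k)%N by rewrite prednK.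
(* The minimum with k - 1 keeps the index in range when x_i = 1, where the scaled coordinate equals
   k. *)
pose c := [ffun i : 'I_d => Ordinal (leq_ltn_trans (geq_minr
  (Num.trunc ((x ord0 i + 1) * (k%:R / 2))) k.-1) pk)].
have xc : cell c x.
  split => // i; rewrite ffunE/=; set t := (_ * _ in X in `|X|).
  have xi : `|x ord0 i| <= 1 by rewrite -Sx; exact: ler_coord_enorm.
  move: xi; rewrite ler_norml => /andP[xi1 xi2].
  have t0 : 0 <= t by rewrite mulr_ge0//; lra.
  have tk : t <= k%:R.
    rewrite -[leRHS](divfK (_ : 2 != 0))// [leRHS]mulrC.
    by apply: ler_wpM2r; [rewrite divr_ge0// ltW|lra].
  have /andP[t1 t2] := truncn_itv t0.
  rewrite ler_norml; have [h|h] := leqP (Num.trunc t) k.-1.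
    by rewrite -natr1 in t2; apply/andP; split; lra.
  have : k.-1.+1%:R <= t by apply: le_trans t1; rewrite ler_nat.
  have kE : k.-1%:R + 1 = k%:R :> R by rewrite natr1 prednK.
  by rewrite -natr1 => h1; apply/andP; split; lra.
exists c; apply: enorm_le_coord => [|i]; first by rewrite divr_ge0// ltW.
have [_ /(_ i) h2] : cell c (xget z (cell c)) by case: xgetP => // /(_ x).
have [_ /(_ i) h1] := xc.
have e : `|x ord0 i - (xget z (cell c)) ord0 i| * (k%:R / 2) <= 2.
  rewrite -[X in _ * X](@gtr0_norm _ (k%:R / 2)) ?divr_gt0// -normrM.
  set y := xget _ _ in h2 *.
  have -> : (x ord0 i - y ord0 i) * (k%:R / 2) =
    ((x ord0 i + 1) * (k%:R / 2) - (c i)%:R) - ((y ord0 i + 1) * (k%:R / 2) - (c i)%:R) by ring.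
  by rewrite (le_trans (ler_normB _ _))//; lra.
rewrite !mxE; move: e; rewrite mulrA ler_pdivrMr// ler_pdivlMr//; lra.
Qed.

(** The k^d caps around the points of the net cover the sphere and have equal mass by invariance. *)
Lemma cap_mass z k : (0 < k)%N -> S z ->
  k%:R^-1 ^+ d <= smean (\1_(cap z (d%:R * (4 / k%:R)))).
Proof.
move=> k0 Sz; have [pt [Spt ptP]] := sphere_net k0 Sz.
set r := d%:R * _ in ptP *.
rewrite exprVn -div1r ler_pdivrMr ?exprn_gt0 ?ltr0n//.
rewrite -{1}(smean_cst sigma_haar 1).
apply: (@le_trans _ _ (smean (fun x => \sum_(c : {ffun 'I_d -> 'I_k}) \1_(cap (pt c) r) x))).
  apply: le_smean => [||x /ptP[c xc]].
  - exact: sbounded_cst.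
  - by apply: sbounded_sum => c; exact: sbounded_cap.
  - rewrite (bigD1 c)//= indicE mem_set//= lerDl.
    by apply: sumr_ge0 => c' _; rewrite indicE.
rewrite (smean_sum sigma_haar) => [|c]; last exact: sbounded_cap.
under eq_bigr do rewrite (smean_cap_eq _ (Spt _) Sz).
by rewrite sumr_const card_ffun !card_ord -natrX mulr_natr.
Qed.

Lemma smean_cap_gt0 z r : 0 < r -> S z -> 0 < smean (\1_(cap z r)).
Proof.
move=> r0 Sz; pose k := (Num.trunc (d%:R * 4 / r)).+1.
have k0 : 0 < k%:R :> R by rewrite ltr0n.
apply: (@lt_le_trans _ _ (k%:R^-1 ^+ d)); first by rewrite exprn_gt0// invr_gt0.
apply: (le_trans (cap_mass _ Sz)) => //.
apply: le_smean => [||x _]; [exact: sbounded_cap..|].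
rewrite !indicE ler_nat; case xz: (x \in _) => //; move: xz => /set_mem; rewrite /cap/= => h.
rewrite mem_set//=; apply: (le_trans h); rewrite mulrA ler_pdivrMr// [leRHS]mulrC -ler_pdivrMr//.
exact/ltW/truncnS_gt.
Qed.

(** The Lipschitz bound keeps |g| at least e / 2 on the cap of radius 4 d / k around [z], whose mass
    is at least k^(-d). *)
Lemma smean_sqr_lower g M z e k : sbounded g -> (0 < k)%N -> S z -> 0 <= e ->
  (forall x y, S x -> S y -> `|g x - g y| <= M * enorm (x - y)) -> 0 <= M ->
  e <= `|g z| -> M * (d%:R * (4 / k%:R)) <= e / 2 ->
  (e / 2) ^+ 2 * k%:R^-1 ^+ d <= smean (fun x => g x ^+ 2).
Proof.
move=> bg k0 Sz e0 gM M0 gz Mk.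
apply: (@le_trans _ _ ((e / 2) ^+ 2 * smean (\1_(cap z (d%:R * (4 / k%:R)))))).
  by apply: ler_wpM2l; [exact: sqr_ge0|exact: cap_mass].
rewrite -smeanZ; last exact: sbounded_cap.
apply: le_smean => [||x Sx]; [exact/sboundedZ/sbounded_cap|exact: sboundedX|].
rewrite indicE; case xz : (x \in _); last by rewrite mulr0 sqr_ge0.
move: xz => /set_mem; rewrite /cap/= => xz; rewrite mulr1 -(real_normK (num_real (g x))).
rewrite ler_sqr ?nnegrE//; last by rewrite divr_ge0.
have h1 := gM _ _ Sz Sx; rewrite enormBC in h1.
have h2 : M * enorm (x - z) <= e / 2 by apply: le_trans Mk; exact: ler_wpM2l.
have h3 := ler_normB (g z - g x) (- g x); rewrite opprK subrK normrN in h3.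
by lra.
Qed.

End Caps.

(** * The spectral gap *)

Section SpectralGap.
Context {R : realType} {d : nat} {sigma : probability (borel_space R d) R}
  (sigma_haar : haar_sphere sigma).
Notation B := (borel_space R d).
Notation S := (@sphere R d).
Notation smean := (smean sigma).
Notation savg := (savg sigma).
Notation zonal := (zonal (sigma := sigma)).
Implicit Types (g h f : 'rV[R]_d -> R) (x y u z : 'rV[R]_d).

Lemma exists_expr_le (q e : R) : 0 <= q < 1 -> 0 < e -> exists n, q ^+ n <= e.
Proof.
move=> /andP[q0 q1] e0.
have q1' : `|q| < 1 by rewrite ger0_norm.
have [n _ /(_ n (leqnn n))] := (cvgr0Pnorm_le _).1 (cvg_expr q1') _ e0.
by rewrite /= ger0_norm ?exprn_ge0// => h; exists n.
Qed.

(** A polynomial in <x, y>, so that its convolution with [f] is a combination of the [zonal f k]; on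
    the sphere its base equals 1 - |x - y|^2 / 4, maximal at y = x. *)
Let ker N x y : R := ((1 + dot x y) / 2) ^+ N.

Let sbounded_ker N x : sbounded (ker N x).
Proof.
apply: sboundedX; under eq_fun do rewrite mulrC; apply: sboundedZ.
by apply: sboundedD; [exact: sbounded_cst|exact: sbounded_dot].
Qed.

Let ker_baseE x y : S x -> S y -> (1 + dot x y) / 2 = 1 - enorm (x - y) ^+ 2 / 4.
Proof.
move=> /sphereE xx /sphereE yy; rewrite sqr_enorm !dotE xx yy (dotC y x); lra.
Qed.

Let ker_base_ge0 x y : S x -> S y -> 0 <= (1 + dot x y) / 2 <= 1.
Proof.
by move=> Sx Sy; have := dot_sphere_le1 Sx Sy;
  rewrite ler_norml => /andP[? ?]; apply/andP; split; lra.
Qed.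

Let ker_smeanE N f x : sbounded f ->
  smean (fun y => ker N x y * f y) =
  \sum_(k < N.+1) (2^-1 ^+ N * 'C(N, k)%:R) * zonal f k x.
Proof.
move=> bf; have bz k : sbounded (fun y => dot x y ^+ k * f y).
  by apply: sboundedM => //; exact/sboundedX/sbounded_dot.
transitivity (smean (fun y => \sum_(k < N.+1)
    (2^-1 ^+ N * 'C(N, k)%:R) * (dot x y ^+ k * f y))).
  apply: eq_smean => y _; rewrite /ker exprMn exprDn !mulr_suml.
  by apply: eq_bigr => k _; rewrite expr1n mul1r -mulr_natr; ring.
rewrite (smean_sum sigma_haar) => [|k]; last exact: sboundedZ.
by apply: eq_bigr => k _; rewrite smeanZ.
Qed.

Let ker_mass N x y : S x -> S y -> smean (ker N x) = smean (ker N y).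
Proof.
move=> /sphereE xx /sphereE yy.
have [Q [QQ xQ _]] := @exists_orthogonal_swap _ _ x y (etrans xx (esym yy)).
rewrite -(smean_orthogonal sigma_haar QQ (sbounded_ker N y)).
by apply: eq_smean => z _; rewrite /ker -xQ dot_orthogonal.
Qed.

(** On the cap of radius r / 2 the base of the kernel is at least 1 - r^2 / 16, which beats its
    bound 1 - r^2 / 4 beyond radius [r]: the mass wins over the tail as [N] grows. *)
Let ker_mass_lower N x r : S x -> 0 < r <= 1 ->
  (1 - r ^+ 2 / 16) ^+ N * smean (\1_(cap x (r / 2))) <= smean (ker N x).
Proof.
move=> Sx /andP[r0 r1]; rewrite -smeanZ; last exact: sbounded_cap.
apply: le_smean => [||y Sy]; [exact/sboundedZ/sbounded_cap|exact: sbounded_ker|].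
have /andP[k0 _] := ker_base_ge0 Sx Sy.
rewrite indicE; case xy : (y \in _); last by rewrite mulr0 exprn_ge0.
move: xy => /set_mem; rewrite /cap/= mulr1 => yx.
have h : enorm (x - y) ^+ 2 <= r ^+ 2 / 4.
  rewrite (_ : r ^+ 2 / 4 = (r / 2) ^+ 2); last by rewrite expr_div_n; congr (_ / _); ring.
  by rewrite ler_sqr ?nnegrE ?enorm_ge0 ?divr_ge0 ?(ltW r0)// enormBC.
apply: lerXn2r; rewrite ?nnegrE//; last by rewrite ker_baseE//; lra.
by have : r ^+ 2 <= 1; [rewrite expr_le1// ltW|lra].
Qed.

(* [ker N x] concentrates at [x] as [N] grows. *)
Let density f M b e : sbounded f -> 0 < e -> 0 <= M ->
  (forall x, S x -> `|f x| <= b) ->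
  (forall x y, S x -> S y -> `|f x - f y| <= M * enorm (x - y)) ->
  exists N (a : nat -> R), forall x, S x ->
    `|\sum_(k < N.+1) a k * zonal f k x - f x| <= e.
Proof.
move=> bf e0 M0 fb fM.
have [[z Sz]|noS] := pselect (exists z, S z); last first.
  by exists 0%N, (fun=> 0) => x Sx; case: noS; exists x.
have b0 : 0 <= b by exact: le_trans (fb _ Sz).
(* Within this radius [f] varies by at most e / 2. *)
pose r := Num.min 1 (e / (2 * (M + 1))).
have r0 : 0 < r by rewrite lt_min ltr01 divr_gt0// mulr_gt0//; lra.
have r1 : r <= 1 by rewrite ge_min lexx.
have Mr : M * r <= e / 2.
  apply: (@le_trans _ _ ((M + 1) * (e / (2 * (M + 1))))).
    apply: ler_pM => //; [exact: ltW|lra|by rewrite ge_min lexx orbT].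
  by rewrite le_eqVlt; apply/orP; left; apply/eqP; field; lra.
pose kap := smean (\1_(cap z (r / 2))).
have kap0 : 0 < kap by apply: smean_cap_gt0 => //; rewrite divr_gt0.
have r2 : 0 < r ^+ 2 <= 1 by rewrite exprn_gt0//= expr_le1// ltW.
have /andP[r2l r2r] := r2.
pose q := (1 - r ^+ 2 / 4) / (1 - r ^+ 2 / 16).
have p0 : 0 < 1 - r ^+ 2 / 16 by lra.
have q01 : 0 <= q < 1.
  by rewrite divr_ge0 ?ltr_pdivrMr//=; [lra|lra|lra].
(* The threshold for q^N that brings the far contribution 2 b (1 - r^2 / 4)^N below e / 2 times the
   kernel mass; the added 1 keeps the denominator positive when b = 0. *)
have c0 : 0 < e * kap / (4 * b + 1) by rewrite divr_gt0 ?mulr_gt0//; lra.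
have [N qN] := exists_expr_le q01 c0.
pose m := smean (ker N z).
have mlow : (1 - r ^+ 2 / 16) ^+ N * kap <= m by apply: ker_mass_lower => //; rewrite r0.
have m0 : 0 < m by apply: lt_le_trans mlow; rewrite mulr_gt0// exprn_gt0.
exists N, (fun k => m^-1 * (2^-1 ^+ N * 'C(N, k)%:R)) => x Sx.
under eq_bigr do rewrite -mulrA.
rewrite -mulr_sumr -ker_smeanE//.
have bkf : sbounded (fun y => ker N x y * f y) by apply: sboundedM.
have -> : m^-1 * smean (fun y => ker N x y * f y) - f x =
    m^-1 * smean (fun y => ker N x y * f y - f x * ker N x y).
  rewrite smeanB//; last exact: sboundedZ.
  by rewrite smeanZ// (ker_mass N Sx Sz) -/m mulrBr [f x * m]mulrC mulKf// gt_eqF.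
rewrite normrM gtr0_norm ?invr_gt0// mulrC ler_pdivrMr//.
have h y : S y -> `|ker N x y * f y - f x * ker N x y| <=
    (e / 2) * ker N x y + 2 * b * (1 - r ^+ 2 / 4) ^+ N.
  move=> Sy; have /andP[k0 k1] := ker_base_ge0 Sx Sy.
  have K0 : 0 <= ker N x y by rewrite exprn_ge0.
  have -> : ker N x y * f y - f x * ker N x y = ker N x y * (f y - f x) by ring.
  rewrite normrM (ger0_norm K0).
  have [yr|ry] := leP (enorm (y - x)) r.
    rewrite -[leLHS]addr0 lerD//.
      rewrite mulrC ler_wpM2r// (le_trans (fM _ _ Sy Sx))//.
      by apply: le_trans Mr; exact: ler_wpM2l.
    by rewrite !mulr_ge0// exprn_ge0//; lra.
  rewrite -[leLHS]add0r lerD//; first by rewrite mulr_ge0//; lra.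
  rewrite mulrC; apply: ler_pM => //.
    by rewrite (le_trans (ler_normB _ _))//; have := fb _ Sx; have := fb _ Sy; lra.
  apply: lerXn2r; rewrite ?nnegrE//; first by lra.
  rewrite ker_baseE// enormBC.
  have : r ^+ 2 <= enorm (y - x) ^+ 2 by rewrite ler_sqr ?nnegrE ?enorm_ge0// ltW.
  by lra.
have bk2 : sbounded (fun y => (e / 2) * ker N x y + 2 * b * (1 - r ^+ 2 / 4) ^+ N).
  by apply: sboundedD; [exact: sboundedZ|exact: sbounded_cst].
have bd : sbounded (fun y => ker N x y * f y - f x * ker N x y).
  by apply: sboundedB => //; exact: sboundedZ.
have up : `|smean (fun y => ker N x y * f y - f x * ker N x y)| <=
    (e / 2) * m + 2 * b * (1 - r ^+ 2 / 4) ^+ N.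
  have -> : (e / 2) * m + 2 * b * (1 - r ^+ 2 / 4) ^+ N =
      smean (fun y => (e / 2) * ker N x y + 2 * b * (1 - r ^+ 2 / 4) ^+ N).
    rewrite smeanD; [|exact: sboundedZ|exact: sbounded_cst].
    by rewrite smeanZ// (smean_cst sigma_haar) (ker_mass N Sx Sz).
  rewrite ler_norml; apply/andP; split.
    rewrite -mulN1r -smeanZ//; apply: le_smean => // [|y Sy]; first exact: sboundedZ.
    by have := h _ Sy; rewrite ler_norml mulN1r => /andP[].
  by apply: le_smean => // y Sy; have := h _ Sy; rewrite ler_norml => /andP[].
apply: (le_trans up).
have : 2 * b * (1 - r ^+ 2 / 4) ^+ N <= e / 2 * m; last by lra.
apply: (@le_trans _ _ (e / 2 * ((1 - r ^+ 2 / 16) ^+ N * kap))); last first.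
  by rewrite ler_wpM2l//; lra.
move: qN; rewrite /q expr_div_n ler_pdivrMr ?exprn_gt0// => qN.
apply: (@le_trans _ _ (2 * b * (e * kap / (4 * b + 1) * (1 - r ^+ 2 / 16) ^+ N))).
  by rewrite ler_wpM2l// mulr_ge0.
set P := (1 - r ^+ 2 / 16) ^+ N.
have P0 : 0 < P by exact: exprn_gt0.
have -> : 2 * b * (e * kap / (4 * b + 1) * P) = (2 * b / (4 * b + 1)) * (e * kap * P).
  by field; lra.
have -> : e / 2 * (P * kap) = 2^-1 * (e * kap * P) by field.
apply: ler_wpM2r; first by rewrite !mulr_ge0// ltW.
by rewrite ler_pdivrMr; lra.
Qed.

Lemma savg_gap (i0 i1 : 'I_d) f M : i0 != i1 -> sbounded f -> smean f = 0 -> 0 <= M ->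
  (forall x y, S x -> S y -> `|f x - f y| <= M * enorm (x - y)) ->
  smean (fun x => savg f x * f x) <= (1 - 2 / d%:R) * smean (fun x => f x ^+ 2).
Proof.
move=> i01 bf f0 M0 fM; have [_ [b0 fb0]] := bf.
pose b := `|b0|; have b_ge0 : 0 <= b := normr_ge0 _.
have fb x : S x -> `|f x| <= b by move=> Sx; rewrite (le_trans (fb0 _ Sx))// ler_norm.
set l := 1 - _; have l0 : 0 <= l := lam1_ge0 sigma_haar i01.
apply/ler_addgt0Pr => e e0.
(* Replacing [f] by its approximation [p] costs at most t (2 b + t) on each side, with the factor
   [l] on the right; as t <= 1, the total is at most t (2 b + 1) (1 + l) <= e. *)
pose t := Num.min 1 (e / (1 + l) / (2 * b + 1)).
have lp : 0 < 1 + l by lra.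
have bp : 0 < 2 * b + 1 by lra.
have t0 : 0 < t by rewrite lt_min ltr01 !divr_gt0.
have t1 : t <= 1 by rewrite ge_min lexx.
have te : t * (2 * b + 1) * (1 + l) <= e.
  by rewrite -ler_pdivlMr// -ler_pdivlMr// ge_min lexx orbT.
have [N [a pf]] := density bf t0 M0 fb fM.
pose p x := \sum_(k < N.+1) a k * zonal f k x.
have bz k : sbounded (fun x => a k * zonal f k x).
  by apply: sboundedZ; exact: sbounded_zonal.
have bp' : sbounded p by apply: sbounded_sum => k; exact: bz.
have dp m : l < m -> savg_decay (sigma := sigma) m p.
  move=> lm; apply: savg_decay_sum => //; first by lra.
  move=> k; apply: savg_decayZ => //; first exact: sbounded_zonal.
  exact: (zonal_decay sigma_haar i01).
have ray := savg_rayleigh sigma_haar l0 bp' dp.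
have pb x : S x -> `|p x| <= b + t.
  move=> Sx; rewrite -(subrK (f x) (p x)) (le_trans (ler_normD _ _))// addrC.
  by rewrite lerD ?fb// pf.
have bTf := sbounded_savg sigma_haar bf; have bTp := sbounded_savg sigma_haar bp'.
have Tp x : S x -> `|savg p x| <= b + t.
  move=> Sx; apply: (ler_norm_smean sigma_haar); first exact: sbounded_orbit.
  by move=> u Su; rewrite pb//; exact: reflection_sphere.
have Tfp x : S x -> `|savg f x - savg p x| <= t.
  move=> Sx; rewrite -smeanB; [|exact: sbounded_orbit..].
  apply: (ler_norm_smean sigma_haar).
    by apply: sboundedB; exact: sbounded_orbit.
  by move=> u Su; rewrite distrC pf//; exact: reflection_sphere.
have h1 : smean (fun x => savg f x * f x) <= smean (fun x => savg p x * p x) + t * (2 * b + t).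
  rewrite -[X in _ <= _ + X](smean_cst sigma_haar) -smeanD;
    [|exact: sboundedM|exact: sbounded_cst].
  apply: le_smean => [||x Sx]; [exact: sboundedM| |].
    by apply: sboundedD; [exact: sboundedM|exact: sbounded_cst].
  have -> : savg f x * f x =
    savg p x * p x + ((savg f x - savg p x) * f x - savg p x * (p x - f x)) by ring.
  rewrite lerD2l (le_trans (ler_norm _))// (le_trans (ler_normB _ _))// !normrM.
  have -> : t * (2 * b + t) = t * b + (b + t) * t by ring.
  by rewrite lerD// ler_pM ?Tfp ?fb ?Tp ?pf.
have h2 : smean (fun x => p x ^+ 2) <= smean (fun x => f x ^+ 2) + t * (2 * b + t).
  rewrite -[X in _ <= _ + X](smean_cst sigma_haar) -smeanD;
    [|exact: sboundedX|exact: sbounded_cst].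
  apply: le_smean => [||x Sx]; [exact: sboundedX| |].
    by apply: sboundedD; [exact: sboundedX|exact: sbounded_cst].
  have -> : p x ^+ 2 = f x ^+ 2 + (p x - f x) * (p x + f x) by ring.
  rewrite lerD2l (le_trans (ler_norm _))// normrM ler_pM ?pf//.
  by rewrite (le_trans (ler_normD _ _))//; have := pb _ Sx; have := fb _ Sx; lra.
have h3 : t * (2 * b + t) <= t * (2 * b + 1) by rewrite ler_wpM2l ?(ltW t0)//; lra.
have h4 : l * smean (fun x => p x ^+ 2) <= l * (smean (fun x => f x ^+ 2) + t * (2 * b + 1)).
  by rewrite ler_wpM2l// (le_trans h2)// lerD2l.
by lra.
Qed.

Lemma symmetral_contraction (i0 i1 : 'I_d) f M :
  i0 != i1 -> sbounded f -> smean f = 0 -> 0 <= M ->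
  (forall x y, S x -> S y -> `|f x - f y| <= M * enorm (x - y)) ->
  smean (fun u => smean (fun x => ((f x + f (reflection u x)) / 2) ^+ 2)) <=
  (1 - d%:R^-1) * smean (fun x => f x ^+ 2).
Proof.
move=> i01 bf f0 M0 fM; have gap := savg_gap i01 bf f0 M0 fM.
have [mf [b fb]] := bf.
have bf2 := sboundedX 2 bf.
pose h u := smean (fun x => f (reflection u x) * f x).
have hE : smean h = smean (fun x => savg f x * f x).
  rewrite /h (@smean_exchange _ _ _ _ (b * b)); first last.
  - by move=> u x Su Sx; rewrite normrM ler_pM// ?fb//; exact: reflection_sphere.
  - apply: measurable_funM; last exact: (measurableT_comp mf).
    by apply: (measurableT_comp mf); apply: measurable_reflection.
  apply: eq_smean => x Sx; rewrite [RHS]mulrC -smeanZ; last exact: sbounded_orbit.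
  by apply: eq_smean => u _; rewrite mulrC.
have bh : sbounded h.
  split.
    apply: (@measurable_smean _ _ _ _ B (fun u x => f (reflection u x) * f x)).
    apply: measurable_funM; last exact: (measurableT_comp mf).
    by apply: (measurableT_comp mf); apply: measurable_reflection.
  exists (b * b) => u Su; apply: (ler_norm_smean sigma_haar).
    by apply: sboundedM => //; exact: sbounded_reflection.
  by move=> x Sx; rewrite normrM ler_pM// ?fb//; exact: reflection_sphere.
set n2 := smean (fun x => f x ^+ 2).
have -> : smean (fun u => smean (fun x => ((f x + f (reflection u x)) / 2) ^+ 2)) =
    smean (fun u => 2^-1 * n2 + 2^-1 * h u).
  apply: eq_smean => u Su.
  have bfu := sbounded_reflection Su bf.
  have bfu2 := sboundedX 2 bfu; have bffu := sboundedM bfu bf.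
  transitivity (smean (fun x => (4^-1 * f x ^+ 2 + 4^-1 * f (reflection u x) ^+ 2)
      + 2^-1 * (f (reflection u x) * f x))).
    by apply: eq_smean => x _; field.
  rewrite !smeanD ?smeanZ//;
    do ?[exact: sboundedZ|apply: sboundedD]; try exact: sboundedZ.
  rewrite (smean_reflection sigma_haar Su (g := fun x => f x ^+ 2)) ?sboundedX//.
  by rewrite -/n2 /h; lra.
rewrite smeanD; [|exact: sbounded_cst|exact: sboundedZ].
rewrite (smean_cst sigma_haar) smeanZ// hE.
apply: le_trans (lerD (lexx _) (ler_wpM2l _ gap)) _ => //.
by rewrite -/n2; lra.
Qed.

End SpectralGap.

(** * Convex bodies and support functions *)

Section ConvexBodies.
Context {R : realType} {d : nat}.
Notation S := (@sphere R d).
Implicit Types (A X Y : set 'rV[R]_d) (x y u theta : 'rV[R]_d).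

Lemma lipschitz_continuous (f : 'rV[R]_d -> R) M : 0 <= M ->
  (forall x y, `|f x - f y| <= M * enorm (x - y)) -> continuous f.
Proof.
move=> M0 fM /= x s /= /(nbhs_ballP (f x))[e /= e0 es].
have c0 : 0 < M * d%:R + 1 by rewrite ltr_wpDl// mulr_ge0.
apply/nbhs_ballP; exists (e / (M * d%:R + 1)) => /=; first by rewrite divr_gt0.
move=> y [_ xy]; apply: es; apply: le_lt_trans (fM x y) _.
have h : enorm (x - y) <= d%:R * (e / (M * d%:R + 1)).
  apply: enorm_le_coord => [|i]; first by rewrite divr_ge0 ?ltW.
  by have := xy ord0 i; rewrite /ball/= !mxE => /ltW.
apply: (le_lt_trans (ler_wpM2l M0 h)).
by rewrite !mulrA ltr_pdivrMr// [ltRHS]mulrC ltr_pM2r// ltrDl.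
Qed.

Lemma enorm_continuous : continuous (@enorm R d).
Proof.
apply: (@lipschitz_continuous _ 1) => // x y; rewrite mul1r ler_norml; apply/andP; split.
  by have := ler_enormD x (y - x); rewrite addrC subrK (enormBC y); lra.
by have := ler_enormD y (x - y); rewrite addrC subrK; lra.
Qed.

Lemma dot_continuous u : continuous (fun x => dot x u).
Proof.
apply: (@lipschitz_continuous _ (enorm u)) => [|x y]; first exact: enorm_ge0.
by rewrite -dotBl mulrC dot_le.
Qed.

Lemma reflection_continuous u : continuous (reflection u).
Proof.
move=> x; apply: (@cvgB _ _ _ (nbhs x)); first exact: cvg_id.
by apply: cvgZr_tmp; apply: cvgM; [exact: cvg_cst|exact: dot_continuous].
Qed.

Definition convexp A := forall x y (t : R), A x -> A y -> 0 <= t <= 1 ->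
  A (t *: x + (1 - t) *: y).

Definition convex_body A := [/\ A !=set0, convexp A & compact A].

Lemma convex_set_convexp A : convex_set (A : set (convex_lmodType 'rV[R]_d)) -> convexp A.
Proof.
move=> cA x y t Ax Ay /andP[t0 t1].
by have := cA x y (Itv01 t0 t1) (mem_set Ax) (mem_set Ay) => /set_mem.
Qed.

Lemma convex_body_bounded A : convex_body A ->
  exists M, 0 <= M /\ forall x, A x -> enorm x <= M.
Proof.
move=> [A0 _ cA].
have [c _ cM] := EVT_max_rV A0 cA (continuous_subspaceT enorm_continuous).
by exists (enorm c); split=> [|x Ax]; [exact: enorm_ge0|apply: cM; exact: mem_set].
Qed.

Lemma convex_body_symmetral u A : convex_body A -> convex_body (minkowski_symmetral u A).
Proof.
move=> [[a Aa] cvA cA]; split.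
- exists (2^-1 *: (a + reflection u a)), (a + reflection u a) => //.
  by exists a => //; exists (reflection u a) => //; exists a.
- move=> _ _ t [_ [a1 Aa1 [_ [b1 Ab1 <-] <-]] <-] [_ [a2 Aa2 [_ [b2 Ab2 <-] <-]] <-] t01.
  exists ((t *: a1 + (1 - t) *: a2) + reflection u (t *: b1 + (1 - t) *: b2)).
    exists (t *: a1 + (1 - t) *: a2); first exact: cvA.
    by exists (reflection u (t *: b1 + (1 - t) *: b2)) => //; eexists => //; exact: cvA.
  by apply/rowP => i; rewrite /reflection !dotE !mxE; ring.
- have -> : minkowski_symmetral u A =
      (fun p => 2^-1 *: (p.1 + reflection u p.2)) @` (A `*` A).
    apply/seteqP; split => [_ [_ [x Ax [_ [y Ay <-] <-]] <-]|_ [[x y] [/= Ax Ay] <-]].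
      by exists (x, y).
    by exists (x + reflection u y) => //; exists x => //; exists (reflection u y) => //; exists y.
  apply: continuous_compact; last exact: compact_setX.
  apply: continuous_subspaceT => p; apply: cvgZl_tmp.
  apply: cvgD; first exact: cvg_fst.
  exact: (continuous_comp cvg_snd (@reflection_continuous u _)).
Qed.

Lemma convex_body_iter (u : nat -> 'rV[R]_d) n A :
  convex_body A -> convex_body (iter_symmetral u n A).
Proof. by move=> bA; elim: n => //= n IH; exact: convex_body_symmetral. Qed.

Lemma dot_bounded A M theta : (forall x, A x -> enorm x <= M) ->
  forall x, A x -> `|dot x theta| <= M * enorm theta.
Proof.
by move=> AM x Ax; rewrite (le_trans (dot_le _ _))// ler_wpM2r ?enorm_ge0// AM.
Qed.

Lemma support_fun_ub A x theta : convex_body A -> A x -> dot x theta <= support_fun A theta.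
Proof.
move=> bA Ax; have [M [_ AM]] := convex_body_bounded bA.
apply: ub_le_sup; last by exists x.
exists (M * enorm theta) => _ [y Ay <-].
by rewrite (le_trans (ler_norm _))// (dot_bounded _ AM).
Qed.

Lemma support_fun_le A theta c : convex_body A ->
  (forall x, A x -> dot x theta <= c) -> support_fun A theta <= c.
Proof.
move=> [[a Aa] _ _] Ac; apply: ge_sup; first by exists (dot a theta), a.
by move=> _ [x Ax <-]; exact: Ac.
Qed.

Lemma support_fun_lipschitz A : convex_body A -> exists M, 0 <= M /\
  forall x y, `|support_fun A x - support_fun A y| <= M * enorm (x - y).
Proof.
move=> bA; have [M [M0 AM]] := convex_body_bounded bA; exists M; split => // x y.
have key z t : support_fun A z <= support_fun A t + M * enorm (z - t).
  apply: support_fun_le => // a Aa.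
  have -> : dot a z = dot a t + dot a (z - t) by rewrite !dotE; ring.
  by rewrite lerD ?support_fun_ub// (le_trans (ler_norm _))// (dot_bounded _ AM).
have := key x y; have := key y x; rewrite (enormBC y) => h1 h2.
by rewrite ler_norml; apply/andP; split; lra.
Qed.

Lemma support_fun_symmetral u A theta : convex_body A ->
  support_fun (minkowski_symmetral u A) theta =
  (support_fun A theta + support_fun A (reflection u theta)) / 2.
Proof.
move=> bA; have bB := convex_body_symmetral u bA.
apply/eqP; rewrite eq_le; apply/andP; split.
  apply: support_fun_le => // _ [_ [a Aa [_ [b Ab <-] <-]] <-].
  rewrite dotZl dotDl dot_reflectionl.
  have := support_fun_ub theta bA Aa; have := support_fun_ub (reflection u theta) bA Ab; lra.
set s := support_fun (minkowski_symmetral u A) theta.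
have key a b : A a -> A b -> dot a theta + dot b (reflection u theta) <= 2 * s.
  move=> Aa Ab; have : dot (2^-1 *: (a + reflection u b)) theta <= s.
    apply: support_fun_ub => //; exists (a + reflection u b) => //.
    by exists a => //; exists (reflection u b) => //; exists b.
  by rewrite dotZl dotDl dot_reflectionl; lra.
(* The two points vary independently, so the supremum is taken over [a] first and then over [b]. *)
have h1 b : A b -> support_fun A theta <= 2 * s - dot b (reflection u theta).
  by move=> Ab; apply: support_fun_le => // a Aa; rewrite lerBrDr key.
have h2 : support_fun A (reflection u theta) <= 2 * s - support_fun A theta.
  by apply: support_fun_le => // b /h1; lra.
by lra.
Qed.

Lemma convex_body_ball (r : R) : 0 <= r -> convex_body (dilate r (@unit_ball R d)).
Proof.
move=> r0; have -> : dilate r (@unit_ball R d) = [set x | enorm x <= r].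
  apply/seteqP; split => [_ [x /= x1 <-]|x /= xr].
    by rewrite /= enormZ ger0_norm// ler_piMr.
  have [r00|rn0] := eqVneq r 0.
    exists 0; rewrite /unit_ball/= ?enorm0 ?ler01// scaler0.
    apply/esym/eqP; rewrite -enorm_eq0 eq_le enorm_ge0 andbT.
    by rewrite (le_trans xr)// r00.
  have rp : 0 < r by rewrite lt_neqAle eq_sym rn0.
  exists (r^-1 *: x); last by rewrite scalerA mulfV// scale1r.
  by rewrite /unit_ball/= enormZ ger0_norm ?invr_ge0// mulrC ler_pdivrMr// mul1r.
split.
- by exists 0; rewrite /= enorm0.
- move=> x y t /= xr yr /andP[t0 t1]; apply: (le_trans (ler_enormD _ _)).
  rewrite !enormZ (ger0_norm t0) ger0_norm ?subr_ge0//.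
  have h1 := ler_wpM2l t0 xr; have h2 : (1 - t) * enorm y <= (1 - t) * r.
    by rewrite ler_wpM2l// subr_ge0.
  by lra.
- apply: bounded_closed_compact.
    exists r; split; first exact: num_real.
    move=> M rM x /= xr; rewrite (le_trans _ (ltW rM))//.
    rewrite [leLHS]mx_normrE; apply: bigmax_le => // -[i j] _.
    by rewrite (ord1 i) (le_trans (ler_coord_enorm _ _)).
  have -> : [set x : 'rV[R]_d | enorm x <= r] = @enorm R d @^-1` [set x | x <= r] by [].
  by apply: closed_comp => [x _|]; [exact: enorm_continuous|exact: closed_le].
Qed.

Lemma support_fun_ball (r : R) theta : 0 <= r -> S theta ->
  support_fun (dilate r (@unit_ball R d)) theta = r.
Proof.
move=> r0 St; have bB := convex_body_ball r0.
apply/eqP; rewrite eq_le; apply/andP; split.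
  apply: support_fun_le => // _ [x /= x1 <-].
  rewrite dotZl ler_piMr// (le_trans (ler_norm _))// (le_trans (dot_le _ _))//.
  by rewrite St mulr1.
have e : dot (r *: theta) theta = r by rewrite dotZl (sphereE theta).1// mulr1.
rewrite -[leLHS]e.
by apply: support_fun_ub => //; exists theta => //; rewrite /unit_ball/=; move: St => ->.
Qed.

(** The variational inequality of the projection onto a compact convex set: if it failed, moving
    from y0 towards [y] would decrease the distance to [x]. *)
Lemma nearest_point Y x : convex_body Y -> exists2 y0, Y y0 &
  forall y, Y y -> dot (x - y0) y <= dot (x - y0) y0.
Proof.
move=> [Y0 cvY cY].
have cf : continuous (fun y => enorm (y - x)).
  move=> y; apply: continuous_comp; last exact: enorm_continuous.
  by apply: (@cvgB _ _ _ (nbhs y)); [exact: cvg_id|exact: cvg_cst].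
have [y0 /set_mem Yy0 ymin] := EVT_min_rV Y0 cY (continuous_subspaceT cf).
exists y0 => // y Yy; rewrite leNgt; apply/negP => h.
set p := dot (x - y0) (y - y0); set q := dot (y - y0) (y - y0).
have p0 : 0 < p by rewrite /p dotBr subr_gt0.
have q0 : 0 <= q by exact: dot_ge0.
(* Moving by [t] changes the squared distance by t (t q - 2 p), which is negative as soon as t q <=
   p. *)
pose t := Num.min 1 (p / (q + 1)).
have t0 : 0 < t by rewrite lt_min ltr01 divr_gt0//; lra.
have t1 : t <= 1 by rewrite ge_min lexx.
have tq : t * (q + 1) <= p by rewrite -ler_pdivlMr; [rewrite ge_min lexx orbT|lra].
have Yt : Y (t *: y + (1 - t) *: y0) by apply: cvY => //; rewrite (ltW t0).
have := ymin _ (mem_set Yt).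
rewrite -ler_sqr ?nnegrE ?enorm_ge0// !sqr_enorm.
have -> : t *: y + (1 - t) *: y0 - x = t *: (y - y0) - (x - y0).
  by apply/rowP => i; rewrite !mxE; ring.
have -> : dot (y0 - x) (y0 - x) = dot (x - y0) (x - y0) by rewrite -opprB dotNl dotNr opprK.
have expand (v w : 'rV[R]_d) : dot (t *: v - w) (t *: v - w) =
    t ^+ 2 * dot v v - 2 * t * dot w v + dot w w by rewrite !dotE (dotC v w); ring.
rewrite expand -/p -/q.
move=> h3; have : 0 < t * (2 * p - t * q) by rewrite mulr_gt0//; lra.
by lra.
Qed.

Let excess X Y : \bar R :=
  ereal_sup [set ereal_inf [set (enorm (x - y))%:E | y in Y] | x in X].

(** Cauchy-Schwarz gives the forward direction. Conversely, let theta be the unit vector from the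
    nearest point y0 of [Y] towards [x]: then <x - y0, theta> is the distance, and y0 attains the
    support value of [Y]. *)
Lemma excess_leP X Y (e : R) : 0 <= e -> convex_body X -> convex_body Y ->
  (excess X Y <= e%:E)%E <->
  forall theta, S theta -> support_fun X theta <= support_fun Y theta + e.
Proof.
move=> e0 bX bY; split => [h theta St|h].
  apply: support_fun_le => // x Xx.
  suff: ((dot x theta - support_fun Y theta)%:E <= e%:E)%E by rewrite lee_fin; lra.
  apply: le_trans h; apply: le_trans (ereal_sup_ubound _); last by exists x.
  apply: le_ereal_inf_tmp => _ [y Yy <-]; rewrite lee_fin.
  have h1 := support_fun_ub theta bY Yy.
  have h2 : dot (x - y) theta <= enorm (x - y).
    by rewrite (le_trans (ler_norm _))// (le_trans (dot_le _ _))// St mulr1.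
  by move: h2; rewrite dotBl; lra.
apply: ge_ereal_sup => _ [x Xx <-].
have [y0 Yy0 y0P] := nearest_point x bY.
apply: (@le_trans _ _ (enorm (x - y0))%:E); first by apply: ereal_inf_lbound; exists y0.
rewrite lee_fin; have [n0|n0] := eqVneq (enorm (x - y0)) 0; first by rewrite n0.
have np : 0 < enorm (x - y0) by rewrite lt_neqAle eq_sym n0 enorm_ge0.
pose theta := (enorm (x - y0))^-1 *: (x - y0).
have St : S theta by rewrite /sphere/= enormZ ger0_norm ?invr_ge0 ?enorm_ge0// mulVf.
have h1 : support_fun Y theta <= dot y0 theta.
  apply: support_fun_le => // y Yy; rewrite /theta !dotZr ler_pM2l ?invr_gt0//.
  by rewrite dotC (dotC y0) y0P.
have h2 : dot (x - y0) theta = enorm (x - y0).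
  by rewrite /theta dotZr -sqr_enorm expr2 mulKf.
have := support_fun_ub theta bX Xx; have := h _ St; move: h2; rewrite dotBl; lra.
Qed.

Lemma hausdorff_leP X Y (e : R) : 0 <= e -> convex_body X -> convex_body Y ->
  (hausdorff_dist X Y <= e%:E)%E <->
  forall theta, S theta -> `|support_fun X theta - support_fun Y theta| <= e.
Proof.
move=> e0 bX bY; rewrite /hausdorff_dist/= ge_max; split.
  move=> /andP[/(excess_leP e0 bX bY) h1 /(excess_leP e0 bY bX) h2] theta St.
  by have := h1 _ St; have := h2 _ St; rewrite ler_norml => ? ?; apply/andP; split; lra.
move=> h; apply/andP; split; apply/excess_leP => // theta /h; rewrite ler_norml => /andP[]; lra.
Qed.

End ConvexBodies.

(** * Iterated averages of Lipschitz functions *)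

(** The effect of [iter_symmetral] on support functions, for arbitrary [f] so that it applies after
    a constant has been subtracted. *)
Fixpoint iter_avg (R : realType) (d : nat) (u : nat -> 'rV[R]_d) (n : nat)
    (f : 'rV[R]_d -> R) (x : 'rV[R]_d) : R :=
  if n is m.+1 then (iter_avg u m f x + iter_avg u m f (reflection (u m) x)) / 2
  else f x.

Section IteratedAverages.
Context {R : realType} {d : nat} {sigma : probability (borel_space R d) R}
  (sigma_haar : haar_sphere sigma).
Notation B := (borel_space R d).
Notation S := (@sphere R d).
Notation smean := (smean sigma).
Implicit Types (f g : 'rV[R]_d -> R) (x y theta : 'rV[R]_d) (u : nat -> 'rV[R]_d).

(** Required on the whole space, where support functions satisfy it, so that it also yields
    continuity and hence Borel measurability. *)
Definition elipschitz M f := forall x y, `|f x - f y| <= M * enorm (x - y).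

Lemma elipschitz_iter_avg M f u n : (forall k, S (u k)) -> elipschitz M f ->
  elipschitz M (iter_avg u n f).
Proof.
move=> Su fM; elim: n => //= n IH x y.
have h1 := IH x y; have := IH (reflection (u n) x) (reflection (u n) y).
rewrite -reflectionB enorm_reflection// => h2.
set a := iter_avg u n f in h1 h2 *.
have -> : (a x + a (reflection (u n) x)) / 2 - (a y + a (reflection (u n) y)) / 2 =
  ((a x - a y) + (a (reflection (u n) x) - a (reflection (u n) y))) / 2 by ring.
rewrite normrM (ger0_norm (_ : 0 <= 2^-1))//.
have := ler_normD (a x - a y) (a (reflection (u n) x) - a (reflection (u n) y)).
by lra.
Qed.

Lemma sbounded_elipschitz M f : 0 <= M -> elipschitz M f -> sbounded f.
Proof.
move=> M0 fM; split.
  by apply: continuous_measurable_borel; exact: (lipschitz_continuous M0).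
exists (`|f 0| + M) => x Sx; have := fM x 0; rewrite subr0 Sx mulr1 => h.
by have := ler_normD (f x - f 0) (f 0); rewrite subrK; lra.
Qed.

Lemma smean_iter_avg f u n : (forall k, S (u k)) -> (forall n, sbounded (iter_avg u n f)) ->
  smean (iter_avg u n f) = smean f.
Proof.
move=> Su bf; elim: n => //= n IH.
under eq_smean do rewrite mulrC.
rewrite smeanZ; last by apply: sboundedD => //; exact: sbounded_reflection.
rewrite smeanD//; last exact: sbounded_reflection.
by rewrite (smean_reflection sigma_haar)// IH; lra.
Qed.

Lemma support_fun_iter A u n theta (c : R) : convex_body A ->
  support_fun (iter_symmetral u n A) theta - c =
  iter_avg u n (fun x => support_fun A x - c) theta.
Proof.
move=> bA; elim: n theta => //= n IH theta.
rewrite support_fun_symmetral; last exact: convex_body_iter.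
by rewrite -!IH; lra.
Qed.

(** The evaluation point is itself a function of [t] because the recursion evaluates at reflected
    points. Measurability is asked of the first [n] directions only, so that the lemma applies over
    the sigma-algebra of the past. *)
Lemma measurable_iter_avg disp (T : measurableType disp) (W : nat -> T -> B) n f (V : T -> B) :
  measurable_fun setT (f : B -> R) ->
  (forall k, (k < n)%N -> measurable_fun setT (W k)) -> measurable_fun setT V ->
  measurable_fun setT (fun t => iter_avg (W^~ t) n f (V t)).
Proof.
move=> mf; elim: n V => [|n IH] V mW mV /=; first exact: (measurableT_comp mf).
have mW' k : (k < n)%N -> measurable_fun setT (W k) by move=> kn; apply: mW; exact: ltnW.
apply: measurable_funM => //; apply: measurable_funD; first exact: IH.
by apply: IH => //; apply: measurable_reflection => //; exact: mW.
Qed.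

(* [f] is at least [e / 2] on a cap of radius proportional to [e], of mass
   proportional to [e ^+ d]. *)
Lemma mean_square_lower M : 0 <= M -> exists2 c : R, 0 < c &
  forall f e z, elipschitz M f -> 0 < e <= 1 -> S z -> e <= `|f z| ->
    c * e ^+ (d + 2) <= smean (fun x => f x ^+ 2).
Proof.
(* With k about 8 M d / e, the Lipschitz variation M (4 d / k) over the cap is at most e / 2; and k
   e <= a because e <= 1, so k^(-d) is at least (e / a)^d. *)
move=> M0; pose a := 8 * M * d%:R + 1.
have a0 : 0 < a by rewrite ltr_wpDl// !mulr_ge0.
exists (4^-1 * a^-1 ^+ d); first by rewrite mulr_gt0// exprn_gt0// invr_gt0.
move=> f e z fM /andP[e0 e1] Sz fz.
pose k := (Num.trunc (8 * M * d%:R / e)).+1.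
have k0 : 0 < k%:R :> R by rewrite ltr0n.
have kr : 8 * M * d%:R / e < k%:R by exact: truncnS_gt.
have ke : k%:R * e <= a.
  have t0 : 0 <= 8 * M * d%:R / e by rewrite !mulr_ge0// invr_ge0 ltW.
  have /andP[tl _] := truncn_itv t0.
  have : k%:R <= 8 * M * d%:R / e + 1 by rewrite /k -natr1 lerD2r tl.
  move=> h; apply: (@le_trans _ _ ((8 * M * d%:R / e + 1) * e)); first by rewrite ler_pM2r.
  by rewrite mulrDl divfK ?gt_eqF// mul1r /a lerD2l.
have Mk : M * (d%:R * (4 / k%:R)) <= e / 2.
  move: kr; rewrite ltr_pdivrMr// => kr.
  by rewrite !mulrA ler_pdivrMr//; lra.
apply: le_trans
  (smean_sqr_lower sigma_haar (sbounded_elipschitz M0 fM) _ Sz (ltW e0) _ M0 fz Mk) => //.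
have -> : 4^-1 * a^-1 ^+ d * e ^+ (d + 2) = (4^-1 * e ^+ 2) * (e / a) ^+ d.
  by rewrite exprMn exprD; ring.
have -> : (e / 2) ^+ 2 = 4^-1 * e ^+ 2 by field.
apply: ler_wpM2l; first by rewrite mulr_ge0// sqr_ge0.
apply: lerXn2r; rewrite ?nnegrE ?divr_ge0 ?invr_ge0 ?(ltW e0) ?(ltW a0) ?(ltW k0)//.
by rewrite -[leRHS]div1r ler_pdivlMr// mulrAC ler_pdivrMr// mul1r mulrC.
Qed.

(** Replaces a quantifier over the uncountable sphere by an integral, which depends
    measurably on parameters. *)
Lemma sup_norm_leP M f e : 0 <= M -> elipschitz M f ->
  (forall x, S x -> `|f x| <= e) <-> smean (fun x => Num.max (`|f x| - e) 0 ^+ 2) = 0.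
Proof.
move=> M0 fM; split => [fe|h x Sx].
  rewrite -[RHS](smean_cst sigma_haar); apply: eq_smean => x Sx.
  by rewrite max_r ?expr0n// subr_le0 fe.
(* The positive part of |f| - e is again Lipschitz, so if it were positive at one point,
   [mean_square_lower] would make its mean square positive. *)
rewrite leNgt; apply/negP => fx; pose g x := Num.max (`|f x| - e) 0.
have gM : elipschitz M g.
  move=> y z; apply: le_trans (fM y z).
  have h1 : `|(`|f y| - e) - (`|f z| - e)| <= `|f y - f z|.
    have -> : (`|f y| - e) - (`|f z| - e) = `|f y| - `|f z| by ring.
    exact: ler_dist_dist.
  rewrite /g !maxEle; move: h1; set p := _ - e; set q := _ - e.
  by case: (leP p 0); case: (leP q 0) => ? ?;
    rewrite !ler_norml => /andP[? ?]; apply/andP; split; lra.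
have gx : 0 < g x by rewrite lt_max subr_gt0 fx.
pose t := Num.min 1 (g x).
have t0 : 0 < t by rewrite lt_min ltr01.
have [c c0 hc] := mean_square_lower M0.
have := hc g t x gM; rewrite t0 ge_min lexx/= => /(_ isT Sx).
rewrite (ger0_norm (ltW gx)) ge_min lexx orbT => /(_ isT).
by rewrite [X in _ <= X]h leNgt mulr_gt0// exprn_gt0.
Qed.

End IteratedAverages.

(** * Independence of the past *)

Section Density.
Context disp (T : measurableType disp) (R : realType) (nu mu : probability T R).

Lemma Radon_Nikodym_le_measure (a : R) : 0 <= a -> nu `<< mu ->
  {ae mu, forall x,
     (('d (charge_of_finite_measure nu) '/d mu) x <= a%:E)%E} ->
  forall E, measurable E -> (nu E <= a%:E * mu E)%E.
Proof.
move=> a0 numu ae_le E mE.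
have -> : nu E = (\int[mu]_(x in E) ('d (charge_of_finite_measure nu) '/d mu) x)%E.
  by rewrite -Radon_Nikodym_integral.
set f := ('d _ '/d _).
have mf : measurable_fun E f.
  by apply: measurable_funTS; apply: measurable_int; exact: Radon_Nikodym_integrable.
(* The derivative is that of a charge, with no pointwise sign at hand; dropping its negative part
   can only increase the integral. *)
rewrite integralE; apply: (@le_trans _ _ (\int[mu]_(x in E) f^\+ x)%E).
  by rewrite -[leRHS]sube0 leeB// integral_ge0.
rewrite -integral_cst//; apply: ae_ge0_le_integral => //.
- exact: measurable_funepos.
- by apply: filterS ae_le => x fx _; rewrite funeposE ge_max fx.
Qed.

End Density.

Section Past.
Context (R : realType) (disp disp' : measure_display) (Omega : measurableType disp)
  (T : measurableType disp') (P : probability Omega R) (U : nat -> {RV P >-> T}).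

(** The past is a smaller sigma-algebra on [Omega] itself, so that functions of
    U_0, ..., U_(n-1) are measurable functions of the sample point and no product
    space is needed. *)
Definition past (n : nat) : set (set Omega) :=
  [set A | exists2 E : nat -> set T, (forall k, measurable (E k)) &
     A = \bigcap_(k in [set` iota 0 n]) (U k @^-1` E k)].

Notation past_space n := (g_sigma_algebraType (past n)).

Lemma past_measurable n : past n `<=` measurable.
Proof.
move=> _ [E mE ->]; apply: fin_bigcap_measurable => // k _.
by rewrite -[X in measurable X]setTI; exact: measurable_funP.
Qed.

Lemma past_setT n : past n setT.
Proof.
exists (fun=> setT) => //; apply/seteqP; split => // w _ k _.
Qed.

Lemma past_setI n : setI_closed (past n).
Proof.
move=> _ _ [E mE ->] [F mF ->]; exists (fun k => E k `&` F k).
  by move=> k; exact: measurableI.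
by rewrite -bigcapI.
Qed.

Lemma measurable_past_id n : measurable_fun setT (id : Omega -> past_space n).
Proof.
apply: (@measurability _ _ Omega (past_space n) setT id (past n)) => //.
by move=> _ [A pA <-]; rewrite setTI preimage_id; exact: past_measurable pA.
Qed.

Lemma measurable_past_RV n k : (k < n)%N -> measurable_fun setT (U k : past_space n -> T).
Proof.
move=> kn _ E mE; rewrite setTI; apply: sub_sigma_algebra.
exists (fun j => if j == k then E else setT); first by move=> j; case: ifP.
apply/seteqP; split => [w /= Ew j _|w /(_ k)].
  by case: eqP => [->|_] //; rewrite preimage_setT.
by rewrite eqxx; apply; rewrite /= mem_iota.
Qed.

Context (U_indep : mutually_independent U).

(** Both sides are finite measures in [A]; they agree on the intersection-stable family [past n] by
    [U_indep], hence on the sigma-algebra it generates. *)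
Lemma past_independent n (E : set T) : measurable E ->
  forall A, <<s past n >> A -> P (A `&` U n @^-1` E) = (P A * P (U n @^-1` E))%E.
Proof.
move=> mE; have mUE : measurable (U n @^-1` E).
  by rewrite -[X in measurable X]setTI; exact: measurable_funP.
pose m1 := mrestr P mUE.
pose k : {nonneg R} := NngNum (fine_ge0 (measure_ge0 P (U n @^-1` E))).
pose m2 := mscale k P.
have kE : (fine (P (U n @^-1` E)))%:E = P (U n @^-1` E) by rewrite fineK// fin_num_measure.
suff m12 A : <<s past n >> A -> m1 A = m2 A.
  by move=> A sA; have := m12 A sA; rewrite /m1 /m2/= /mrestr /mscale/= kE muleC.
apply: (g_sigma_algebra_measure_unique (past n) _ (fun=> setT)) => //.
- exact: past_measurable.
- by move=> _; exact: past_setT.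
- by apply/seteqP; split => // w _; exists 0%N.
- exact: past_setI.
- move=> _ [F mF ->]; rewrite /m1 /m2/= /mrestr /mscale/= kE.
  (* Putting [E] at index [n] turns the left side into an intersection over the first n + 1
     variables. *)
  pose F' j := if j == n then E else F j.
  have mF' j : measurable (F' j) by rewrite /F'; case: ifP.
  have F'E j : j \in iota 0 n -> F' j = F j.
    by rewrite mem_iota add0n /F' => /andP[_ jn]; rewrite ltn_eqF.
  have -> : \bigcap_(j in [set` iota 0 n]) (U j @^-1` F j) `&` U n @^-1` E =
      \bigcap_(j in [set` iota 0 n.+1]) (U j @^-1` F' j).
    rewrite -addn1 iotaD add0n; apply/seteqP; split => [w [wF wE] j|w h].
      rewrite /= mem_cat mem_seq1 => /orP[jn|/eqP ->]; last by rewrite /F' eqxx.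
      by rewrite F'E//; exact: wF.
    split=> [j jn|].
      by rewrite /= -F'E//; apply: h; rewrite /= mem_cat jn.
    by have := h n; rewrite /F' eqxx; apply; rewrite /= mem_cat mem_seq1 eqxx orbT.
  rewrite !U_indep ?iota_uniq// -addn1 iotaD add0n big_cat/= big_seq1 /F' eqxx muleC.
  by congr (_ * _)%E; apply: eq_big_seq => j jn; rewrite -/(F' j) F'E.
- move=> _; rewrite /m1/= /mrestr (le_lt_trans (probability_le1 _ _)) ?ltry//.
  by rewrite setTI.
Qed.

(** This stands in for conditional expectation: by independence the sample point, seen through the
    past, and U_n have a product law, and Tonelli integrates out the newest variable. *)
Lemma integral_past_RV n (Psi : past_space n * T -> \bar R) :
  measurable_fun setT Psi -> (forall p, 0 <= Psi p)%E ->
  (\int[P]_w Psi (w, U n w) = \int[P]_w \int[distribution P (U n)]_u Psi (w, u))%E.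
Proof.
move=> mPsi Psi0.
pose idn : {RV P >-> past_space n} := HB.pack (id : Omega -> past_space n)
  (isMeasurableFun.Build _ _ _ _ _ (@measurable_past_id n)).
have mJ : measurable_fun setT (fun w : Omega => (w : past_space n, U n w)).
  by apply: measurable_fun_pair => //; exact: measurable_past_id.
pose J : {RV P >-> (past_space n * T)%type} := HB.pack
  (fun w : Omega => (w : past_space n, U n w))
  (isMeasurableFun.Build _ _ _ _ _ mJ).
rewrite -[LHS](ge0_integral_distribution J mPsi Psi0).
transitivity (\int[distribution P idn \x distribution P (U n)]_p Psi p)%E.
  apply: eq_measure_integral => A mA _; apply/esym.
  apply: product_measure_unique => // A1 E mA1 mE.
  exact: (past_independent mE mA1).
rewrite fubini_tonelli1//.
rewrite (ge0_integral_distribution idn)//.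
  exact: measurable_fun_fubini_tonelli_F.
by move=> w; apply: integral_ge0.
Qed.

End Past.

(** * The first index *)

Section FirstIndex.
Context (R : realType).
Implicit Types H : nat -> Prop.

Lemma first_index_fromP H :
  (exists N, [/\ first_index_from R H = N%:R%:E, forall n, (N <= n)%N -> H n &
     forall k, N = k.+1 -> ~ H k]) \/
  (first_index_from R H = +oo%E /\ forall N, exists2 n, (N <= n)%N & ~ H n).
Proof.
have [[N0 HN0]|no] := pselect (exists N, forall n, (N <= n)%N -> H n); last first.
  right; split; last first.
    move=> N; apply: contrapT => h; apply: no; exists N => n Nn.
    by apply: contrapT => nH; apply: h; exists n.
  rewrite /first_index_from (_ : [set N%:R%:E | N in _] = set0) ?ereal_inf0//.
  by apply/seteqP; split => // y [N HN _]; case: no; exists N.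
have ex : exists N, `[< forall n, (N <= n)%N -> H n >] by exists N0; apply/asboolP.
left; case: (ex_minnP ex) => N /asboolP HN Nmin; exists N; split => //.
- apply/eqP; rewrite eq_le; apply/andP; split.
    by apply: ereal_inf_lbound; exists N.
  apply: le_ereal_inf_tmp => _ [k Hk <-]; rewrite lee_fin ler_nat.
  by apply: Nmin; apply/asboolP.
- move=> k Nk Hk; have : (N <= k)%N.
    apply: Nmin; apply/asboolP => n; rewrite leq_eqVlt => /predU1P[<-//|kn].
    by apply: HN; rewrite Nk.
  by rewrite Nk ltnn.
Qed.

Context disp (T : measurableType disp) (H : nat -> T -> Prop)
  (mH : forall n, measurable [set t | H n t]).

Lemma measurable_first_index_from :
  measurable_fun setT (fun t => first_index_from R (H^~ t)).
Proof.
pose G N := [set t | forall n, (N <= n)%N -> H n t].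
have mG N : measurable (G N).
  have -> : G N = \bigcap_(n in [set n | (N <= n)%N]) [set t | H n t].
    by apply/seteqP; split.
  by apply: bigcap_measurableType => n _; exact: mH.
(* The first index is the infimum of these countably many functions. *)
pose h N t : \bar R := if t \in G N then N%:R%:E else +oo%E.
have mh N : measurable_fun setT (h N).
  apply: measurable_fun_ifT => //; apply: (measurable_fun_bool true).
  rewrite setTI (_ : _ @^-1` _ = G N)//.
  by apply/seteqP; split => t; [move=> /= /set_mem|move=> Gt; exact: mem_set].
rewrite (_ : (fun t => _) = (fun t => einfs (h^~ t) 0%N)).
  exact: measurable_fun_einfs.
apply/funext => t; rewrite /first_index_from /einfs /sdrop.
apply/eqP; rewrite eq_le; apply/andP; split.
  apply: le_ereal_inf_tmp => _ [N _ <-]; rewrite /h; case: ifPn => [|_]; last exact: leey.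
  by move=> /set_mem GN; apply: ereal_inf_lbound; exists N.
apply: le_ereal_inf_tmp => _ [N GN <-]; apply: ereal_inf_lbound.
by exists N => //; rewrite /h mem_set.
Qed.

Lemma measurable_expeR_first_index (l : R) : 0 < l ->
  measurable_fun setT (fun t => expeR (l%:E * first_index_from R (H^~ t))).
Proof.
move=> l0; have mfi := measurable_first_index_from.
rewrite (_ : (fun t => _) = fun t => if first_index_from R (H^~ t) == +oo%E then +oo%E
   else (expR (l * fine (first_index_from R (H^~ t))))%:E).
  apply: measurable_fun_ifT => //.
    apply: (measurable_fun_bool true).
    rewrite (_ : _ @^-1` _ = (fun t => first_index_from R (H^~ t)) @^-1` [set +oo%E]).
      by apply: mfi => //; exact: emeasurable_set1.
    by apply/seteqP; split => t /= /eqP.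
  apply: measurableT_comp => //; apply: measurableT_comp; first exact: measurable_expR.
  by apply: measurable_funM => //; apply: measurableT_comp => //; exact: fine_measurable.
apply/funext => t; case: (first_index_fromP (H^~ t)) => [[N [-> _ _]]|[-> _]] //=.
by rewrite gt0_muley ?lte_fin.
Qed.

(** If the first index is k + 1, the failure at k already contributes exp(l (k + 1)). The term 1
    covers index 0, and an infinite index means infinitely many failures, so the series diverges. *)
Lemma expeR_first_index_le (l : R) t : 0 < l ->
  (expeR (l%:E * first_index_from R (H^~ t)) <=
   1 + \sum_(0 <= n <oo) (expR (l * n.+1%:R) * \1_(~` [set t | H n t]) t)%:E)%E.
Proof.
move=> l0; set F := fun n => (expR (l * n.+1%:R) * \1_(~` [set t | H n t]) t)%:E.
have F0 n : (0 <= F n)%E by rewrite lee_fin mulr_ge0 ?expR_ge0.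
have Fk k : ~ H k t -> ((expR (l * k.+1%:R))%:E <= \sum_(0 <= n <oo) F n)%E.
  move=> nH; apply: (@le_trans _ _ (\sum_(0 <= n < k.+1) F n)%E); last exact: nneseries_lim_ge.
  rewrite big_nat_recr//= -[leLHS]add0e leeD//; first exact: sume_ge0.
  by rewrite /F indicE mem_set// mulr1.
have S0 : (0 <= \sum_(0 <= n <oo) F n)%E by exact: nneseries_ge0.
case: (first_index_fromP (H^~ t)) => [[[|k] [-> _ nH]]|[-> inf]].
- by rewrite -EFinM mulr0n mulr0 /= expR0 leeDl.
- rewrite -EFinM /= -[leLHS]add0e leeD//; exact/Fk/nH.
- suff -> : (\sum_(0 <= n <oo) F n = +oo)%E by rewrite addey// leey.
  apply/eqyP => A A0; have [n Nn /Fk] := inf (Num.trunc (A / l)); apply: le_trans.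
  rewrite lee_fin; apply: (@le_trans _ _ (l * n.+1%:R)).
    rewrite -ler_pdivrMl// mulrC; apply/ltW; apply: lt_le_trans (truncnS_gt _) _.
    by rewrite ler_nat.
  by apply: le_trans (expR_ge1Dx _); rewrite lerDr.
Qed.

Lemma nneseries_geometric_lt (F : nat -> \bar R) (K r : R) : 0 <= K -> 0 <= r < 1 ->
  (forall n, 0 <= F n <= (K * r ^+ n)%:E)%E -> (\sum_(0 <= n <oo) F n < +oo)%E.
Proof.
move=> K0 /andP[r0 r1] FK; apply: (@le_lt_trans _ _ (K / (1 - r))%:E); last exact: ltry.
have r1' : 0 < 1 - r by rewrite subr_gt0.
apply: lime_le; first by apply: is_cvg_nneseries => n _ _; case/andP: (FK n).
apply: nearW => n; apply: (@le_trans _ _ (\sum_(0 <= i < n) (K * r ^+ i)%:E)%E).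
  by apply: lee_sum => i _; case/andP: (FK i).
rewrite sumEFin lee_fin -mulr_sumr ler_wpM2l// -[leRHS]div1r ler_pdivlMr//.
elim: n => [|n IH]; first by rewrite big_nil mul0r.
suff : (\sum_(0 <= i < n.+1) r ^+ i) * (1 - r) = 1 - r ^+ n.+1.
  by move=> ->; rewrite gerBl exprn_ge0.
elim: n.+1 => [|m IHm]; first by rewrite big_nil mul0r expr0 subrr.
by rewrite big_nat_recr//= mulrDl IHm exprS; ring.
Qed.

End FirstIndex.

(** Failures decay at rate 2 l against weights growing at rate [l], which leaves a geometric series
    of ratio exp(-l). *)
Lemma exponential_moment_first_index (R : realType) disp (T : measurableType disp)
    (P : probability T R) (H : nat -> T -> Prop) (K l : R) :
  (forall n, measurable [set t | H n t]) -> 0 <= K -> 0 < l ->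
  (forall n, P (~` [set t | H n t]) <= (K * expR (- (2 * l) * n%:R))%:E)%E ->
  (\int[P]_t expeR (l%:E * first_index_from R (H^~ t)) < +oo)%E.
Proof.
move=> mH K0 l0 PH.
have mHC n : measurable (~` [set t | H n t]) by exact: measurableC.
pose F n t : \bar R := (expR (l * n.+1%:R) * \1_(~` [set t | H n t]) t)%:E.
have F0 n t : (0 <= F n t)%E by rewrite lee_fin mulr_ge0 ?expR_ge0.
have mF n : measurable_fun setT (F n).
  by apply: measurableT_comp => //; apply: measurable_funM => //; exact: measurable_indic.
have mS : measurable_fun setT (fun t => \sum_(0 <= n <oo) F n t)%E.
  exact: ge0_emeasurable_sum.
apply: (@le_lt_trans _ _ (\int[P]_t (1 + \sum_(0 <= n <oo) F n t))%E).
  apply: ge0_le_integral => //.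
  - by move=> t _; exact: expeR_ge0.
  - exact: measurable_expeR_first_index.
  - by apply: emeasurable_funD.
  - by move=> t _; exact: expeR_first_index_le.
rewrite ge0_integralD//; last by move=> t _; exact: nneseries_ge0.
rewrite integral_cst//= mul1e probability_setT integral_nneseries//.
rewrite lte_add_pinfty ?ltry//.
apply: (@nneseries_geometric_lt _ _ (expR l * K) (expR (- l))).
- by rewrite mulr_ge0 ?expR_ge0.
- by rewrite expR_ge0 expR_lt1 oppr_lt0.
- move=> n; rewrite integral_ge0//=.
  have -> : (\int[P]_t F n t = (expR (l * n.+1%:R))%:E * P (~` [set t | H n t]))%E.
    have -> : P (~` [set t | H n t]) = (\int[P]_t (\1_(~` [set t | H n t]) t)%:E)%E.
      by rewrite integral_indic// setIT.
    by rewrite -ge0_integralZl// ?lee_fin ?expR_ge0//; apply: measurableT_comp.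
  apply: le_trans (lee_wpmul2l _ (PH n)) _; first by rewrite lee_fin expR_ge0.
  rewrite -EFinM lee_fin mulrCA -expRD -expRM_natr mulrAC -expRD mulrC ler_pM// ler_expR.
  by rewrite -natr1; lra.
Qed.

(** * Random symmetrizations *)

Section RandomSymmetrization.
Context {R : realType} {d : nat} {sigma : probability (borel_space R d) R}
  (sigma_haar : haar_sphere sigma) (i0 i1 : 'I_d) (i01 : i0 != i1).
Notation B := (borel_space R d).
Notation S := (@sphere R d).
Notation smean := (smean sigma).
Context disp (Omega : measurableType disp) (P : probability Omega R)
  (U : nat -> {RV P >-> borel_space R d})
  (U_sphere : forall k w, S (U k w))
  (U_indep : mutually_independent U) (a : R) (a_ge0 : 0 <= a)
  (U_le : forall k E, measurable E -> (distribution P (U k) E <= a%:E * sigma E)%E).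
Context (f : 'rV[R]_d -> R) (M : R) (M_ge0 : 0 <= M) (f_lip : elipschitz M f)
  (f_mean : smean f = 0).

Let F n w : 'rV[R]_d -> R := iter_avg (fun k => U k w) n f.
Let X n w : R := smean (fun x => F n w x ^+ 2).

Let lipF n w : elipschitz M (F n w).
Proof. exact: elipschitz_iter_avg. Qed.

Let bF n w : sbounded (F n w).
Proof. exact: sbounded_elipschitz (lipF n w). Qed.

Let mf : measurable_fun setT (f : B -> R).
Proof. by case: (bF 0%N point). Qed.

Let X_ge0 n w : 0 <= X n w.
Proof. by apply: smean_ge0 => x _; exact: sqr_ge0. Qed.

Lemma measurable_iter_avg_RV n : measurable_fun setT (fun p : Omega * B => F n p.1 p.2).
Proof.
apply: (@measurable_iter_avg _ _ _ (Omega * B)%type (fun k p => U k p.1) n f snd) => //.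
by move=> k _; apply: (measurableT_comp _ measurable_fst).
Qed.

Let measurable_X n : measurable_fun setT (X n).
Proof.
apply: (@measurable_smean _ _ _ _ _ (fun w x => F n w x ^+ 2)).
by apply: measurable_funX; exact: measurable_iter_avg_RV.
Qed.

(** Given the past, [F n w] is a fixed Lipschitz function of mean 0. The law of U_n is dominated by
    [a] times [sigma], under which [symmetral_contraction] gives the factor 1 - 1/d. *)
Lemma mean_square_step n :
  (\int[P]_w (X n.+1 w)%:E <= (a * (1 - d%:R^-1))%:E * \int[P]_w (X n w)%:E)%E.
Proof.
pose psi w u : R := smean (fun x => ((F n w x + F n w (reflection u x)) / 2) ^+ 2).
have bpsi w : sbounded (psi w).
  have [_ [b Fb]] := bF n w; split.
    apply: (@measurable_smean _ _ _ _ B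
      (fun u x => ((F n w x + F n w (reflection u x)) / 2) ^+ 2)).
    have mFw : measurable_fun setT (F n w : B -> R) by case: (bF n w).
    apply: measurable_funX; apply: measurable_funM => //; apply: measurable_funD.
      exact: (measurableT_comp mFw).
    by apply: (measurableT_comp mFw); apply: measurable_reflection.
  exists (b ^+ 2) => u Su; apply: (ler_norm_smean sigma_haar).
    apply: sboundedX; under eq_fun do rewrite mulrC; apply: sboundedZ.
    by apply: sboundedD => //; exact: sbounded_reflection.
  move=> x Sx; rewrite normrX lerXn2r ?nnegrE//.
    by apply: le_trans (Fb _ Sx).
  rewrite normrM (ger0_norm (_ : 0 <= 2^-1))//.
  have := ler_normD (F n w x) (F n w (reflection u x)).
  have := Fb _ Sx; have := Fb _ (reflection_sphere Su Sx); lra.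
(* The indicator turns integrals over the whole space into means over the sphere and leaves the
   value at U_n unchanged. *)
pose Psi (p : g_sigma_algebraType (past U n) * B) : \bar R := (psi p.1 p.2 * \1_S p.2)%:E.
have Psi0 p : (0 <= Psi p)%E.
  rewrite lee_fin mulr_ge0//; apply: smean_ge0 => x _; exact: sqr_ge0.
have mPsi : measurable_fun setT Psi.
  apply: measurableT_comp => //; apply: measurable_funM; last first.
    apply: (@measurableT_comp _ _ _ _ _ _ (\1_S : B -> R)) => //.
    by apply: measurable_indic; exact: measurable_sphere.
  pose T := ((g_sigma_algebraType (past U n) * B)%type : measurableType _).
  apply: (@measurable_smean _ _ _ _ T
    (fun p x => ((F n p.1 x + F n p.1 (reflection p.2 x)) / 2) ^+ 2)).
  (* Only U_k with k < n occurs in [F n], so [Psi] is measurable over the past. *)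
  have mU k : (k < n)%N -> measurable_fun setT (fun p : T * B => U k p.1.1).
    move=> kn; apply: (@measurableT_comp _ _ _ _ _ _ (U k : g_sigma_algebraType (past U n) -> B)).
      exact: measurable_past_RV.
    exact: (measurableT_comp measurable_fst measurable_fst).
  apply: measurable_funX; apply: measurable_funM => //; apply: measurable_funD.
    by apply: (@measurable_iter_avg _ _ _ (T * B)%type (fun k p => U k p.1.1) n f snd).
  apply: (@measurable_iter_avg _ _ _ (T * B)%type (fun k p => U k p.1.1) n f
    (fun p => reflection p.1.2 p.2)) => //.
  by apply: measurable_reflection => //; exact: (measurableT_comp measurable_snd measurable_fst).
have XE w : (X n.+1 w)%:E = Psi (w, U n w).
  by rewrite /Psi/= indicE mem_set// mulr1.
under eq_integral do rewrite XE.
rewrite (integral_past_RV U_indep mPsi Psi0).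
pose ka : {nonneg R} := NngNum a_ge0.
have step w : (\int[distribution P (U n)]_u Psi (w, u) <= (a * (1 - d%:R^-1) * X n w)%:E)%E.
  have mPw : measurable_fun setT (fun u => Psi (w, u)).
    exact: (measurableT_comp mPsi (pair1_measurable _)).
  apply: (@le_trans _ _ (\int[mscale ka sigma]_u Psi (w, u))%E).
    by apply: ge0_le_measure_integral => // E mE; exact: U_le.
  rewrite ge0_integral_mscale//= -mulrA EFinM.
  apply: lee_wpmul2l; first by rewrite lee_fin.
  have -> : (\int[sigma]_u Psi (w, u) = (smean (psi w))%:E)%E.
    rewrite EFin_smean// [RHS]integral_mkcond; apply: eq_integral => u _.
    by rewrite /Psi/= patchE indicE; case: (u \in _); rewrite ?mulr1 ?mulr0.
  rewrite lee_fin; apply: (@symmetral_contraction _ _ _ sigma_haar _ _ _ M i01) => //.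
    by rewrite /F (smean_iter_avg sigma_haar)// => m; exact: bF.
  by move=> x y _ _; exact: lipF.
have q0 : 0 <= a * (1 - d%:R^-1).
  rewrite mulr_ge0// subr_ge0 invf_le1 ?ler1n ?ltr0n; by case: (d) i0 => [[]|].
have mXE : measurable_fun setT (fun w => (X n w)%:E) by apply: measurableT_comp.
rewrite -ge0_integralZl ?lee_fin//; last by move=> w _; rewrite lee_fin.
apply: ge0_le_integral => //.
- by move=> w _; apply: integral_ge0.
- have m : measurable_fun setT (fun w : g_sigma_algebraType (past U n) =>
      \int[distribution P (U n)]_u Psi (w, u))%E.
    exact: measurable_fun_fubini_tonelli_F.
  exact: (measurableT_comp m (@measurable_past_id _ _ _ _ _ _ _ n)).
- by apply: measurable_funeM; apply: measurableT_comp => //; exact: measurable_X.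
Qed.

Lemma mean_square_decay n : (\int[P]_w (X n w)%:E <=
  ((a * (1 - d%:R^-1)) ^+ n * smean (fun x => f x ^+ 2))%:E)%E.
Proof.
have q0 : 0 <= a * (1 - d%:R^-1).
  rewrite mulr_ge0// subr_ge0 invf_le1 ?ler1n ?ltr0n; by case: (d) i0 => [[]|].
elim: n => [|n IH].
  by rewrite expr0 mul1r /X /F /= integral_cst//= probability_setT mule1.
apply: le_trans (mean_square_step n) _; rewrite exprS -[in leRHS]mulrA [in leRHS]EFinM.
by apply: lee_wpmul2l.
Qed.

(** [sup_norm_leP] writes this event as the zero set of a mean that depends measurably on the sample
    point. *)
Lemma measurable_sup_norm_le n e :
  measurable [set w | forall x, S x -> `|F n w x| <= e].
Proof.
pose G w x := Num.max (`|F n w x| - e) 0 ^+ 2.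
have -> : [set w | forall x, S x -> `|F n w x| <= e] =
    (fun w => smean (G w)) @^-1` [set 0].
  by apply/seteqP; split => w /= /(sup_norm_leP sigma_haar _ M_ge0 (lipF n w)).
rewrite -[X in measurable X]setTI.
have mG : measurable_fun setT (fun w => smean (G w)); last exact: mG.
apply: (@measurable_smean _ _ _ _ _ G); apply: measurable_funX.
apply: measurable_maxr => //; apply: measurable_funB => //.
by apply: measurableT_comp => //; exact: measurable_iter_avg_RV.
Qed.

(** A value above [e] at one point forces a mean square of at least c e^(d + 2), so Markov's
    inequality applies to [X n]. *)
Lemma sup_norm_tail : exists2 K : R, 0 <= K & forall n e, 0 < e <= 1 ->
  (P (~` [set w | forall x, S x -> (`|F n w x| <= e)%R]) <=
   (K * ((a * (1 - d%:R^-1)) ^+ n / e ^+ (d + 2)))%:E)%E.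
Proof.
have [c c0 hc] := mean_square_lower sigma_haar M_ge0.
set v := smean (fun x => f x ^+ 2).
have v0 : 0 <= v by apply: smean_ge0 => x _; exact: sqr_ge0.
exists (v / c); first by rewrite divr_ge0// ltW.
move=> n e e01; have /andP[e0 _] := e01.
set E := ~` _; have mE : measurable E by apply: measurableC; exact: measurable_sup_norm_le.
have ce0 : 0 < c * e ^+ (d + 2) by rewrite mulr_gt0// exprn_gt0.
have h : ((c * e ^+ (d + 2))%:E * P E <= \int[P]_w (X n w)%:E)%E.
  have -> : P E = (\int[P]_w (\1_E w)%:E)%E by rewrite integral_indic// setIT.
  have m1E : measurable_fun setT (fun w => (\1_E w)%:E : \bar R).
    by apply: measurableT_comp => //; exact: measurable_indic.
  rewrite -ge0_integralZl ?lee_fin ?(ltW ce0)//.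
  apply: ge0_le_integral => //.
  - by move=> w _; rewrite -EFinM lee_fin mulr_ge0// ltW.
  - exact: measurable_funeM.
  - by apply: measurableT_comp => //; exact: measurable_X.
  - move=> w _; rewrite -EFinM lee_fin indicE; case wE : (w \in E); last by rewrite mulr0.
    rewrite mulr1; move: wE => /set_mem/existsNP[x /not_implyP[Sx /negP]].
    by rewrite -ltNge => /ltW xe; exact: hc (lipF n w) e01 Sx xe.
have := le_trans h (mean_square_decay n); rewrite -/v.
have PE : P E \is a fin_num by rewrite fin_num_measure.
rewrite -(fineK PE) -EFinM !lee_fin => h2.
have ee : e ^+ (d + 2) != 0 by rewrite gt_eqF// exprn_gt0.
rewrite (_ : v / c * _ = (a * (1 - d%:R^-1)) ^+ n * v / (c * e ^+ (d + 2))).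
  by rewrite ler_pdivlMr// mulrC.
by field; rewrite ee gt_eqF.
Qed.

End RandomSymmetrization.

(** L(A) is at least the mean of <a, .> for any point a of A, and that mean is 0 by antipodal
    symmetry. Nonnegativity lets L(A) be the support function of L(A) D. *)
Lemma mean_radius_ge0 (R : realType) (d : nat) (sigma : probability (borel_space R d) R)
    (A : set 'rV[R]_d) : haar_sphere sigma -> convex_body A -> 0 <= mean_radius sigma A.
Proof.
move=> sigma_haar bA; have [M [M0 lipA]] := support_fun_lipschitz bA.
have bs := sbounded_elipschitz M0 lipA; have [[a Aa] _ _] := bA.
have NQ : (- 1%:M : 'M[R]_d) *m (- 1%:M)^T = 1%:M.
  by rewrite linearN/= trmx1 mulmxN mulNmx mulmx1 opprK.
have Na : smean sigma (dot a) = - smean sigma (dot a).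
  rewrite -{1}(smean_orthogonal sigma_haar NQ (sbounded_dot a)).
  transitivity (smean sigma (fun x => -1 * dot a x)).
    by apply: eq_smean => x _; rewrite mulmxN mulmx1 dotNr mulN1r.
  by rewrite smeanZ ?mulN1r//; exact: sbounded_dot.
apply: (@le_trans _ _ (smean sigma (dot a))); first by lra.
by apply: le_smean => // [|x _]; [exact: sbounded_dot|exact: support_fun_ub].
Qed.

Theorem theorem2 (R : realType) (d : nat) (d_ge2 : (2 <= d)%N)
    (sigma : probability (borel_space R d) R) (sigma_haar : haar_sphere sigma)
    (A : set 'rV[R]_d) (A_neq0 : A !=set0)
    (A_convex : convex_set (A : set (convex_lmodType 'rV[R]_d)))
    (A_compact : compact A)
    (disp : measure_display) (Omega : measurableType disp)
    (P : probability Omega R)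
    (U : nat -> {RV P >-> borel_space R d})
    (U_sphere : forall k w, sphere (U k w))
    (U_indep : mutually_independent U)
    (alpha : R) (alpha_gt0 : 0 < alpha)
    (alpha_lt : alpha < d%:R / (d%:R - 1))
    (U_ac : forall k, distribution P (U k) `<< sigma)
    (U_density : forall k, {ae sigma, forall u,
       (('d (charge_of_finite_measure (distribution P (U k))) '/d sigma) u
          <= alpha%:E)%E}) :
  let ineq (c : R) (w : Omega) (n : nat) : Prop :=
    (hausdorff_dist (iter_symmetral (fun k => U k w) n A)
       (dilate (mean_radius sigma A) unit_ball)
     <= (expR (- c * n%:R))%:E)%E in
  exists c : R,
    [/\ 0 < c,
        {ae P, forall w, exists n0 : nat,
           forall n : nat, (n0 <= n)%N -> ineq c w n},
        measurable_fun setT (fun w => first_index_from R (ineq c w)) &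
        exists lambda : R, 0 < lambda /\
          (\int[P]_w expeR (lambda%:E * first_index_from R (ineq c w))
             < +oo)%E].
Proof.
move=> ineq.
pose i0 : 'I_d := Ordinal (ltnW d_ge2); pose i1 : 'I_d := Ordinal d_ge2.
have i01 : i0 != i1 by [].
have bA : convex_body A by split => //; exact: convex_set_convexp.
have [M [M0 lipA]] := support_fun_lipschitz bA.
set L := mean_radius sigma A in ineq *.
have L0 : 0 <= L by exact: mean_radius_ge0.
pose f x := support_fun A x - L.
have lipf : elipschitz M f by move=> x y; rewrite /f opprB addrA subrK; exact: lipA.
have fmean : smean sigma f = 0.
  rewrite smeanB; [|exact: sbounded_elipschitz lipA|exact: sbounded_cst].
  by rewrite (smean_cst sigma_haar) subrr.
have U_le k E : measurable E -> (distribution P (U k) E <= alpha%:E * sigma E)%E.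
  exact: (Radon_Nikodym_le_measure (ltW alpha_gt0) (U_ac k) (U_density k)).
have [K K0 tail] :=
  sup_norm_tail sigma_haar i01 U_sphere U_indep (ltW alpha_gt0) U_le M0 lipf fmean.
have d1 : 1 < d%:R :> R by rewrite ltr1n.
pose q : R := alpha * (1 - d%:R^-1).
have q0 : 0 < q by rewrite mulr_gt0// subr_gt0 invf_lt1//; lra.
have q1 : q < 1.
  move: alpha_lt; rewrite ltr_pdivlMr ?subr_gt0// => h.
  rewrite /q (_ : alpha * (1 - d%:R^-1) = alpha * (d%:R - 1) / d%:R).
    by rewrite ltr_pdivrMr ?mul1r//; lra.
  by field; lra.
pose rate := - ln q.
have rate0 : 0 < rate by rewrite oppr_gt0 ln_lt0// q0.
have qE : q = expR (- rate) by rewrite opprK lnK// posrE.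
pose D : R := (d + 2)%:R.
have D0 : 0 < D by rewrite ltr0n addn_gt0 orbT.
(* By [tail] the failure probability at [n] is at most
   K expR (- rate n) / expR (- c D n) = K expR (- (rate / 2) n). *)
pose c := rate / (2 * D); pose lambda := rate / 4.
have c0 : 0 < c by rewrite divr_gt0 ?mulr_gt0.
have lambda0 : 0 < lambda by rewrite divr_gt0.
have ineqE n w : ineq c w n <-> forall x, sphere x ->
    `|iter_avg (fun k => U k w) n f x| <= expR (- c * n%:R).
  have P1 := hausdorff_leP (expR_ge0 (- c * n%:R)) (convex_body_iter (fun k => U k w) n bA)
    (convex_body_ball L0).
  rewrite /ineq; apply: (iff_trans P1); split => h x Sx; have := h x Sx;
    by rewrite support_fun_ball// support_fun_iter.
have setE n : [set w | ineq c w n] = [set w | forall x, sphere x ->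
    `|iter_avg (fun k => U k w) n f x| <= expR (- c * n%:R)].
  by apply/seteqP; split => w /ineqE.
have mH n : measurable [set w | ineq c w n].
  by rewrite setE; exact: (measurable_sup_norm_le sigma_haar U_sphere M0 lipf).
have PH n : (P (~` [set w | ineq c w n]) <= (K * expR (- (2 * lambda) * n%:R))%:E)%E.
  rewrite setE; apply: le_trans (tail n (expR (- c * n%:R)) _) _.
    by rewrite expR_gt0 -expR0 ler_expR mulNr oppr_le0 mulr_ge0// ltW.
  rewrite lee_fin ler_wpM2l// -/q qE -!expRM_natr -expRN -expRD ler_expR -/D.
  rewrite /lambda /c le_eqVlt; apply/orP; left; apply/eqP; field; lra.
have moment := exponential_moment_first_index mH K0 lambda0 PH.
have mfi := measurable_first_index_from mH.
exists c; split => //; last by exists lambda.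
(* Almost sure finiteness is read off the moment rather than from Borel-Cantelli: an integrable
   function is finite almost everywhere, and this one is +oo wherever the first index is
   infinite. *)
have mex := measurable_expeR_first_index mH lambda0.
have ifi : P.-integrable setT (fun w => expeR (lambda%:E * first_index_from R (ineq c w))).
  apply/integrableP; split => //.
  by under eq_integral do rewrite gee0_abs ?expeR_ge0//.
apply: filterS (integrable_ae measurableT ifi) => w /(_ I).
case: (first_index_fromP R (ineq c w)) => [[N [_ HN _]] _|[-> _]]; first by exists N.
by rewrite gt0_muley// lte_fin.
Qed.
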